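(* Let $\Gamma'=\langle S\mid R'\rangle$ be the finitely presented group with $$S=\{a,b,c,d,a^{-1},b^{-1},c^{-1},d^{-1}\},$$ $$R'=\{a^{-1}ba=b^{2},\ b^{-2}cb^2=c^{2},\ c^{-3}dc^3=d^{2},\ d^{-4}ad^4=a^{2}\}.$$ Then the Cayley graph $G=(V,E)$ of $\Gamma'$ with respect to $S$ has no graph height function.
   Context: Cayley graphs: for a group $\Gamma$ with identity $\mathbf 1$ and a finite generating set $S$ with $S^{-1}=S$ and $\mathbf 1\notin S$, the Cayley graph is the simple graph with vertex-set $V=\Gamma$ and an undirected edge $\langle\gamma_1,\gamma_2\rangle$ if and only if $\gamma_2=\gamma_1 s$ for some $s\in S$. Graph height functions: let $G=(V,E)$ be an infinite, locally finite, connected, vertex-transitive simple graph with a distinguished vertex $\mathbf 1$ (the identity in the case of a Cayley graph), and let $\partial v$ denote the set of neighbours of $v$. For $\mathcal H\le\mathrm{Aut}(G)$, a function $F:V\to\mathbb R$ is $\mathcal H$-difference-invariant if $F(v)-F(w)=F(\gamma v)-F(\gamma w)$ for all $v,w\in V$ and $\gamma\in\mathcal H$. A subgroup of $\mathrm{Aut}(G)$ acts quasi-transitively if it has finitely many orbits on $V$. A graph height function on $G$ is a pair $(h,\mathcal H)$ where $\mathcal H\le\mathrm{Aut}(G)$ acts quasi-transitively on $G$ and $h:V\to\mathbb Z$ satisfies: (a) $h(\mathbf 1)=0$; (b) $h$ is $\mathcal H$-difference-invariant; (c) for every $v\in V$ there exist $u,w\in\partial v$ with $h(u)<h(v)<h(w)$.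 *)

(* Defs.v *)
From HB Require Import structures.
From mathcomp Require Import all_boot all_order all_algebra.
From mathcomp Require Import boolp classical_sets functions cardinality.
Set Implicit Arguments.
Unset Strict Implicit.
Unset Printing Implicit Defensive.
Import Order.TTheory GRing.Theory Num.Theory.
Local Open Scope classical_set_scope.
Local Open Scope quotient_scope.

(* (x, false) stands for the generator x, (x, true) for x^-1. *)
Definition letter (X : Type) : Type := (X * bool)%type.
Definition word (X : Type) : Type := seq (letter X).
Definition letter_inv (X : Type) (l : letter X) : letter X := (l.1, ~~ l.2).
Definition word_inv (X : Type) (w : word X) : word X :=
  rev (map (@letter_inv X) w).

(* The least monoid congruence on words that contains the relations [l = r]
   for (l, r) in R and makes the two letters of each generator mutually
   inverse; the classes are the elements of the group < X | R >. *)
Inductive pres_eq (X : choiceType) (R : seq (word X * word X)) :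
    word X -> word X -> Prop :=
| pres_refl u : pres_eq R u u
| pres_sym u v : pres_eq R u v -> pres_eq R v u
| pres_trans u v w : pres_eq R u v -> pres_eq R v w -> pres_eq R u w
| pres_cat u u' v v' :
    pres_eq R u u' -> pres_eq R v v' -> pres_eq R (u ++ v) (u' ++ v')
| pres_cancel l : pres_eq R [:: l; letter_inv l] [::]
| pres_rel l r : (l, r) \in R -> pres_eq R l r.

Section PresentedGroup.
Variables (X : choiceType) (R : seq (word X * word X)).

Definition pres_eqb : rel (word X) := fun u v => `[< pres_eq R u v >].

Lemma pres_eqb_refl : reflexive pres_eqb.
Proof. by move=> u; apply/asboolP; apply: pres_refl. Qed.

Lemma pres_eqb_sym : symmetric pres_eqb.
Proof. by move=> u v; apply/asboolP/asboolP; apply: pres_sym. Qed.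

Lemma pres_eqb_trans : transitive pres_eqb.
Proof.
by move=> v u w /asboolP uv /asboolP vw; apply/asboolP; apply: pres_trans uv vw.
Qed.

Canonical pres_equiv :=
  EquivRel pres_eqb pres_eqb_refl pres_eqb_sym pres_eqb_trans.

Definition presented_group := {eq_quot pres_equiv}.

Implicit Types (u v w : word X) (x y z : presented_group).

Definition pres_class u : presented_group := \pi u.

Lemma pres_classP u v : pres_class u = pres_class v <-> pres_eq R u v.
Proof.
split; first by move/eqmodP => /asboolP.
by move=> uv; apply/eqmodP/asboolP.
Qed.

Lemma pres_classK x : pres_class (repr x) = x.
Proof. exact: reprK. Qed.

Lemma letter_invK : involutive (@letter_inv X).
Proof. by case=> x b; rewrite /letter_inv /= negbK. Qed.

Lemma word_inv_cat u v : word_inv (u ++ v) = word_inv v ++ word_inv u.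
Proof. by rewrite /word_inv map_cat rev_cat. Qed.

Lemma word_invK : involutive (@word_inv X).
Proof.
by move=> u; rewrite /word_inv map_rev revK -map_comp map_id_in // => l _ /=;
  rewrite letter_invK.
Qed.

Lemma pres_mulV u : pres_eq R (u ++ word_inv u) [::].
Proof.
elim: u => [|l u IHu]; first exact: pres_refl.
rewrite -cat1s word_inv_cat.
have -> : ([:: l] ++ u) ++ (word_inv u ++ word_inv [:: l]) =
          [:: l] ++ ((u ++ word_inv u) ++ word_inv [:: l]) by rewrite !catA.
apply: (@pres_trans _ _ _ ([:: l] ++ ([::] ++ word_inv [:: l]))).
  apply: pres_cat; first exact: pres_refl.
  by apply: pres_cat; last exact: pres_refl.
exact: pres_cancel.
Qed.

Lemma pres_inv u v : pres_eq R u v -> pres_eq R (word_inv u) (word_inv v).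
Proof.
move=> uv.
apply: (@pres_trans _ _ _ (word_inv u ++ (v ++ word_inv v))).
  rewrite -[X in pres_eq R X]cats0; apply: pres_cat; first exact: pres_refl.
  exact/pres_sym/pres_mulV.
rewrite catA -[X in pres_eq R _ X]cat0s.
apply: pres_cat; last exact: pres_refl.
apply: (@pres_trans _ _ _ (word_inv u ++ u)).
  by apply: pres_cat; [exact: pres_refl|exact: pres_sym].
by rewrite -{2}[u]word_invK; apply: pres_mulV.
Qed.

Definition pres_mul x y := pres_class (repr x ++ repr y).
Definition pres_one := pres_class [::].
Definition pres_invg x := pres_class (word_inv (repr x)).

Lemma pres_repr u : pres_eq R (repr (pres_class u)) u.
Proof. exact/pres_classP/pres_classK. Qed.

Lemma pres_mulE u v : pres_mul (pres_class u) (pres_class v) = pres_class (u ++ v).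
Proof. by apply/pres_classP; apply: pres_cat; apply: pres_repr. Qed.

Lemma pres_invE u : pres_invg (pres_class u) = pres_class (word_inv u).
Proof. by apply/pres_classP; apply: pres_inv; apply: pres_repr. Qed.

Lemma pres_classW (P : presented_group -> Prop) :
  (forall u, P (pres_class u)) -> forall x, P x.
Proof. by move=> Pcl x; rewrite -(pres_classK x). Qed.

Lemma pres_mulA : associative pres_mul.
Proof.
elim/pres_classW=> u; elim/pres_classW=> v; elim/pres_classW=> w.
by rewrite !pres_mulE catA.
Qed.

Lemma pres_mul1g : left_id pres_one pres_mul.
Proof. by elim/pres_classW=> u; rewrite pres_mulE. Qed.

Lemma pres_mulg1 : right_id pres_one pres_mul.
Proof. by elim/pres_classW=> u; rewrite pres_mulE cats0. Qed.

Lemma pres_mulgV : right_inverse pres_one pres_invg pres_mul.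
Proof.
elim/pres_classW=> u; rewrite pres_invE pres_mulE.
exact/pres_classP/pres_mulV.
Qed.

Lemma pres_mulVg : left_inverse pres_one pres_invg pres_mul.
Proof.
elim/pres_classW=> u; rewrite pres_invE pres_mulE; apply/pres_classP.
by rewrite -{2}[u]word_invK; apply: pres_mulV.
Qed.

HB.instance Definition _ := Choice.on presented_group.
HB.instance Definition _ := isGroup.Build presented_group
  pres_mulA pres_mul1g pres_mulg1 pres_mulVg pres_mulgV.

Definition pres_gen (a : X) : presented_group := pres_class [:: (a, false)].

End PresentedGroup.

Definition neighbours (V : Type) (adj : V -> V -> Prop) (v : V) : set V :=
  [set u | adj v u].

Definition cayley_adj (gT : groupType) (S : set gT) (x y : gT) : Prop :=
  exists2 s, S s & y = (x * s)%g.

Definition automorphism (V : Type) (adj : V -> V -> Prop) : set (V -> V) :=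
  [set f | bijective f /\ forall u v, adj (f u) (f v) <-> adj u v].

Definition aut_subgroup (V : Type) (adj : V -> V -> Prop)
    (H : set (V -> V)) : Prop :=
  [/\ H `<=` automorphism adj,
      H id,
      forall f g, H f -> H g -> H (f \o g)
    & forall f g, H f -> cancel f g -> cancel g f -> H g].

Definition aut_orbit (V : Type) (H : set (V -> V)) (v : V) : set V :=
  [set f v | f in H].

Definition quasi_transitive (V : Type) (H : set (V -> V)) : Prop :=
  finite_set (range (aut_orbit H)).

Definition difference_invariant (V : Type) (U : zmodType) (H : set (V -> V))
    (F : V -> U) : Prop :=
  forall v w f, H f -> (F v - F w = F (f v) - F (f w))%R.

Definition graph_height_function (V : Type) (adj : V -> V -> Prop) (o : V)
    (h : V -> int) (H : set (V -> V)) : Prop :=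
  [/\ aut_subgroup adj H /\ quasi_transitive H,
      h o = 0%R,
      difference_invariant H h
    & forall v, exists u w,
        [/\ neighbours adj v u, neighbours adj v w & (h u < h v < h w)%R]].

Variant gen4 : Set := GenA | GenB | GenC | GenD.
HB.instance Definition _ := gen_eqMixin gen4.
HB.instance Definition _ := gen_choiceMixin gen4.

(* The relation x^-n y x^n = y^2. *)
Definition conj_square (n : nat) (x y : gen4) : word gen4 * word gen4 :=
  (nseq n (x, true) ++ [:: (y, false)] ++ nseq n (x, false),
   nseq 2 (y, false)).

Definition Gamma_rels : seq (word gen4 * word gen4) :=
  [:: conj_square 1 GenA GenB;
      conj_square 2 GenB GenC;
      conj_square 3 GenC GenD;
      conj_square 4 GenD GenA].

Definition Gamma : groupType := presented_group Gamma_rels.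

Definition Gamma_gens : set Gamma :=
  let a : Gamma := pres_gen Gamma_rels GenA in
  let b : Gamma := pres_gen Gamma_rels GenB in
  let c : Gamma := pres_gen Gamma_rels GenC in
  let d : Gamma := pres_gen Gamma_rels GenD in
  [set a; b; c; d; a^-1%g; b^-1%g; c^-1%g; d^-1%g].

(* Main.v *)
Require Import Defs.
From HB Require Import structures.
From mathcomp Require Import all_boot all_order all_algebra.
From mathcomp Require Import boolp classical_sets functions cardinality.
From mathcomp Require Import zify.
Set Implicit Arguments.
Unset Strict Implicit.
Unset Printing Implicit Defensive.
Import Order.TTheory GRing.Theory Num.Theory.

(** Write each vertex v of the Cayley graph with its eight outgoing edges labelled
    by the letters a, b, c, d and their inverses.  The graph is rigid: every
    automorphism f satisfies f (v * g) = f v * g ([automorphism_translation]).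
    Granting this, let H be quasi-transitive with a height function h.  Right
    multiplication by Gamma then permutes the finitely many H-orbits, and the
    classical argument of Higman ([higman_orders]) forces this finite action to be
    trivial.  Hence H contains left multiplication by every generator, so h is a
    homomorphism from Gamma to the integers; a relator x^-n y x^n = y^2 gives
    h y = 2 h y, so h vanishes on all generators, and no vertex has a higher
    neighbour.

    Rigidity.  An automorphism carries a closed walk to a closed walk of the same
    length, that is, a trivial word to a trivial word.  The only trivial words of
    length five are the rotations of a b^2 a^-1 b^-1 and of its inverse
    ([trivial5]).  Call two edges at a vertex linked when they are consecutive in a
    pentagon.  Each b-edge is linked to three others and each a-edge only to
    b-edges, so automorphisms preserve the a-edges and the b-edges
    ([preserves_AB]).  The image of the relator c b^2 = b^2 c^2 then separates
    c-edges from d-edges ([preserves_C]), and the image of y x^n = x^n y^2 shows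
    that the direction of the x-edges is preserved, for each generator x
    ([preserves_orient]).

    All of this needs only three facts about a trivial word of Gamma: no generator
    occurs in it exactly once ([count_letter_neq1]); if it is written in two
    opposite generators (a and c, or b and d), each occurs an even number of times
    ([opposite_even]); and if it is written in two adjacent generators x and y,
    it is already trivial in an explicit quotient of < x, y | x^-n y x^n = y^2 >,
    a group of pairs of an integer and a function on the integers ([edge_value]).
    They are read off from a group satisfying the relators of Gamma
    ([square_model_exists]).  Glue the explicit groups for (a, b) and (b, c) along
    the infinite cyclic group of b, glue those for (c, d) and (d, a) along d, and
    glue the results along the subgroup generated by a and c, which is free of
    rank two in both ([edge_amalgam]).  Amalgams are realised by permutations of
    normal forms ([amalgam]). *)

Local Open Scope group_scope.

(** * Homomorphisms and groups of permutations *)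

Section Morphisms.
Variables (G H : groupType) (f : G -> H).
Hypothesis fM : {morph f : x y / x * y}.

Lemma morph_one : f 1 = 1.
Proof. by apply: (@mulgI _ (f 1)); rewrite -fM !mulg1. Qed.

Lemma morph_inv : {morph f : x / x^-1}.
Proof. by move=> x; apply/esym/mulg1_eq; rewrite -fM mulgV morph_one. Qed.

Lemma morph_expn n : {morph f : x / x ^+ n}.
Proof. by move=> x; elim: n => [|n IHn]; rewrite ?morph_one // !expgS fM IHn. Qed.

End Morphisms.

Lemma morph_inj (G H : groupType) (f : G -> H) :
  {morph f : x y / x * y} -> (forall x, f x = 1 -> x = 1) -> injective f.
Proof.
by move=> fM f1 x y E; apply/divg1_eq/f1; rewrite fM (morph_inv fM) E mulgV.
Qed.

Record sym (X : Type) := Sym {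
  sym_fun :> X -> X;
  sym_inv : X -> X;
  sym_funK : cancel sym_fun sym_inv;
  sym_invK : cancel sym_inv sym_fun }.

Section Symmetric.
Variable X : Type.
Implicit Types p q r : sym X.

Lemma sym_eq p q : p =1 q -> p = q.
Proof.
case: p q => [p p' pK p'K] [q q' qK q'K] /= /funext pq; subst q.
have : p' = q' by apply/funext => x; rewrite -{1}[x]q'K pK.
move=> ?; subst q'.
by congr Sym; apply: Prop_irrelevance.
Qed.

Definition sym_one : sym X := @Sym X id id (fun=> erefl) (fun=> erefl).
Definition sym_mul p q : sym X :=
  Sym (can_comp (@sym_funK _ p) (@sym_funK _ q))
      (can_comp (@sym_invK _ q) (@sym_invK _ p)).
Definition sym_inverse p : sym X := Sym (@sym_invK _ p) (@sym_funK _ p).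

HB.instance Definition _ := gen_eqMixin (sym X).
HB.instance Definition _ := gen_choiceMixin (sym X).

Fact sym_mulA : associative sym_mul.
Proof. by move=> p q r; apply: sym_eq. Qed.
Fact sym_mul1 : left_id sym_one sym_mul.
Proof. by move=> p; apply: sym_eq. Qed.
Fact sym_mulr1 : right_id sym_one sym_mul.
Proof. by move=> p; apply: sym_eq. Qed.
Fact sym_mulV : left_inverse sym_one sym_inverse sym_mul.
Proof. by move=> p; apply: sym_eq => x /=; rewrite sym_funK. Qed.
Fact sym_mulrV : right_inverse sym_one sym_inverse sym_mul.
Proof. by move=> p; apply: sym_eq => x /=; rewrite sym_invK. Qed.

HB.instance Definition _ :=
  isGroup.Build (sym X) sym_mulA sym_mul1 sym_mulr1 sym_mulV sym_mulrV.

Lemma sym_of_action (A : groupType) (act : A -> X -> X) :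
    (forall x, act 1 x = x) -> (forall a b x, act (a * b) x = act a (act b x)) ->
  exists2 f : A -> sym X,
    {morph f : a b / a * b} & forall a, f a =1 act a.
Proof.
move=> act1 actM.
have K a : cancel (act a) (act a^-1) by move=> x; rewrite -actM mulVg act1.
have K' a : cancel (act a^-1) (act a) by move=> x; rewrite -actM mulgV act1.
exists (fun a => Sym (K a) (K' a)) => // a b.
by apply: sym_eq => x /=; rewrite actM.
Qed.

End Symmetric.

(** * Amalgamated products *)

(** A transversal of the right cosets i(F) x, in the form of an F-equivariant
    bijection: [None] stands for the coset i(F), and P for the other cosets. *)
Lemma coset_coordinates (F A : groupType) (i : F -> A) :
    {morph i : x y / x * y} -> injective i ->
  exists (P : Type) (phi : F * option P -> A) (psi : A -> F * option P),
    [/\ cancel phi psi, cancel psi phi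
      & forall f f' o, phi (f * f', o) = i f * phi (f', o)].
Proof.
move=> iM i_inj; have i1 := morph_one iM; have iV := morph_inv iM.
pose coset x : pred A := fun y => `[< exists f, y = i f * x >].
pose rep x := if coset 1 x then 1 else choose (coset x) x.
have cosetxx x : coset x x by apply/asboolP; exists 1; rewrite i1 mul1g.
have repP x : exists f, x = i f * rep x.
  rewrite /rep; case: ifP => [/asboolP|_]; first exact.
  have /asboolP[f ->] := chooseP (cosetxx x).
  by exists f^-1; rewrite mulgA -iM mulVg i1 mul1g.
have cosetM f x : coset (i f * x) =1 coset x.
  move=> y; apply/asboolP/asboolP => -[f' ->].
    by exists (f' * f); rewrite iM mulgA.
  by exists (f' * f^-1); rewrite mulgA -iM mulgVK.
have repM f x : rep (i f * x) = rep x.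
  rewrite /rep; have -> : coset 1 (i f * x) = coset 1 x.
    apply/asboolP/asboolP => -[f']; rewrite !mulg1 => E.
      by exists (f^-1 * f'); rewrite mulg1 iM -E iV mulKg.
    by exists (f * f'); rewrite mulg1 E iM.
  case: ifP => // _.
  rewrite -(eq_choose (cosetM f x)) (@choose_id _ _ (i f * x) x) //.
  by apply/asboolP; exists f^-1; rewrite iV mulKg.
have rep1 : rep 1 = 1 by rewrite /rep cosetxx.
have rep_id x : rep (rep x) = rep x.
  by have [f E] := repP x; rewrite [in RHS]E repM.
pose T := {t : A | (rep t == t) && (t != 1)}.
pose phi (p : F * option T) := i p.1 * (if p.2 is Some t then val t else 1).
have /choice[fp fpP] := repP.
pose psi x : F * option T := (fp x, insub (rep x)).
exists T, phi, psi; split=> [[f o]|x|f f' o].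
- have E : rep (phi (f, o)) = (if o is Some t then val t else 1).
    by rewrite /phi repM /=; case: o => [[t /= /andP[/eqP ? _]]|].
  rewrite /psi; congr pair.
    by apply/i_inj/(@mulIg _ (rep (phi (f, o)))); rewrite -fpP E.
  rewrite E; case: o E => [t _|_]; first by rewrite valK.
  by rewrite insubF // eqxx andbF.
- rewrite /phi /psi /=; case: insubP => [t _ ->|]; first by rewrite -fpP.
  by rewrite rep_id eqxx /= negbK => /eqP r1; rewrite [RHS]fpP r1.
- by rewrite /phi /= iM mulgA.
Qed.

(** Alternating sequences of cosets whose first entry, if any, lies in Q.  The
    swapped parameters in the recursive occurrence enforce the alternation. *)
Inductive alternating (P Q : Type) : Type :=
| AltNil
| AltCons of Q & alternating Q P.

(** Normal forms of an amalgam, up to their initial factor in F. *)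
Inductive syllables (P Q : Type) : Type :=
| SylNil
| SylL of P & alternating P Q
| SylR of Q & alternating Q P.

Arguments AltNil {P Q}.
Arguments SylNil {P Q}.
Arguments SylL {P Q}.
Arguments SylR {P Q}.

Definition leadL P Q (n : syllables P Q) := if n is SylL _ _ then true else false.
Definition leadR P Q (n : syllables P Q) := if n is SylR _ _ then true else false.

Definition swap_syl P Q (n : syllables P Q) : syllables Q P :=
  match n with
  | SylNil => SylNil
  | SylL p w => SylR p w
  | SylR q w => SylL q w
  end.

Lemma swap_sylK P Q : cancel (@swap_syl P Q) (@swap_syl Q P).
Proof. by case. Qed.

Lemma leadL_swap P Q (n : syllables P Q) : leadL (swap_syl n) = leadR n.
Proof. by case: n. Qed.

Lemma leadR_swap P Q (n : syllables P Q) : leadR (swap_syl n) = leadL n.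
Proof. by case: n. Qed.

(** A acts on F * syllables P Q through the identification of this set with
    A * alternating P Q, where A acts by left multiplication.  The other factor
    acts in the same way after exchanging P and Q. *)
Section HalfAction.
Variables (F A : groupType) (i : F -> A) (P Q : Type).
Variables (phi : F * option P -> A) (psi : A -> F * option P).
Hypothesis iM : {morph i : x y / x * y}.
Hypothesis phiK : cancel phi psi.
Hypothesis psiK : cancel psi phi.
Hypothesis phiM : forall f f' o, phi (f * f', o) = i f * phi (f', o).

Definition split_syl (x : F * syllables P Q) : A * alternating P Q :=
  match x.2 with
  | SylNil => (phi (x.1, None), AltNil)
  | SylL p w => (phi (x.1, Some p), w)
  | SylR q w => (phi (x.1, None), AltCons q w)
  end.

Definition join_syl (x : A * alternating P Q) : F * syllables P Q :=
  let y := psi x.1 in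
  (y.1, match y.2, x.2 with
        | Some p, w => SylL p w
        | None, AltNil => SylNil
        | None, AltCons q w => SylR q w
        end).

Lemma split_sylK : cancel split_syl join_syl.
Proof. by case=> f [|p w|q w]; rewrite /join_syl /split_syl /= phiK. Qed.

Lemma join_sylK : cancel join_syl split_syl.
Proof.
move=> [a w]; rewrite /join_syl /split_syl /=.
by case E : (psi a) => [f [p|]] /=; case: w => [|q w]; rewrite -E psiK.
Qed.

Definition half_act (a : A) (x : F * syllables P Q) :=
  let y := split_syl x in join_syl (a * y.1, y.2).

Lemma half_act1 x : half_act 1 x = x.
Proof.
by rewrite /half_act mul1g -surjective_pairing split_sylK.
Qed.

Lemma half_actM a b x : half_act (a * b) x = half_act a (half_act b x).
Proof. by rewrite /half_act join_sylK /= mulgA. Qed.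

Lemma half_actF f f' n : half_act (i f) (f', n) = (f * f', n).
Proof.
rewrite /half_act -[RHS]split_sylK; congr join_syl.
by case: n => [|p w|q w] /=; rewrite /split_syl /= phiM.
Qed.

(** The coset of a f is not i(F), so it becomes a new leading syllable. *)
Lemma half_act_lead a x : (forall f, a <> i f) -> ~~ leadL x.2 ->
  leadL (half_act a x).2.
Proof.
move=> aF.
have N f : (psi (a * phi (f, None))).2 <> None.
  case E : (psi _) => [f' [//|]] _; apply: (aF (f' * f^-1)).
  have := congr1 phi E; rewrite psiK -[f in LHS]mulg1 phiM -[f' in RHS]mulg1 phiM.
  rewrite mulgA => /mulIg.
  by rewrite iM => <-; rewrite (morph_inv iM) mulgK.
case: x => f [|p w|q w] //= _; rewrite /half_act /split_syl /join_syl /=;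
by case E : (psi _).2 => [p|] //; case: (N f).
Qed.

Lemma half_act_free a x : half_act a x = x -> a = 1.
Proof.
move/(congr1 split_syl); rewrite join_sylK [split_syl x]surjective_pairing.
by case=> /esym E; apply: (@mulIg _ (split_syl x).1); rewrite mul1g -E.
Qed.

End HalfAction.

(** The normal form theorem in a form suited to ping-pong: [lead s g] says that the
    normal form of g, obtained by applying g to the trivial normal form, starts with
    a syllable from the factor s (true for A, false for B).  Multiplication on the
    left by an element of one factor outside F creates a leading syllable of that
    factor unless there is one already. *)
Lemma amalgam (F A B : groupType) (i : F -> A) (j : F -> B) :
    {morph i : x y / x * y} -> {morph j : x y / x * y} ->
    injective i -> injective j ->
  exists (G : groupType) (alpha : A -> G) (beta : B -> G)
         (lead : bool -> G -> bool),
    [/\ [/\ {morph alpha : x y / x * y}, {morph beta : x y / x * y},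
            injective alpha & injective beta],
        forall f, alpha (i f) = beta (j f),
        forall f s, ~~ lead s (alpha (i f)),
        forall s g, lead s g -> ~~ lead (~~ s) g
      & (forall a g, (forall f, a <> i f) -> ~~ lead true g ->
           lead true (alpha a * g)) /\
        (forall b g, (forall f, b <> j f) -> ~~ lead false g ->
           lead false (beta b * g))].
Proof.
move=> iM jM i_inj j_inj.
have [P [phA [psA [phAK psAK phAM]]]] := coset_coordinates iM i_inj.
have [Q [phB [psB [phBK psBK phBM]]]] := coset_coordinates jM j_inj.
pose X : Type := F * syllables P Q.
pose swp P Q (x : F * syllables P Q) := (x.1, swap_syl x.2).
have swpK P' Q' : cancel (@swp P' Q') (@swp Q' P').
  by case=> f n; rewrite /swp /= swap_sylK.
pose actA := half_act phA psA (Q := Q) : A -> X -> X.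
pose actB b (x : X) : X := swp _ _ (half_act phB psB (Q := P) b (swp _ _ x)).
have [al alM alE] : exists2 f : A -> sym X,
    {morph f : a b / a * b} & forall a, f a =1 actA a.
  apply: sym_of_action; first by move=> x; rewrite /actA half_act1.
  by move=> a b x; rewrite /actA half_actM.
have [be beM beE] : exists2 f : B -> sym X,
    {morph f : a b / a * b} & forall a, f a =1 actB a.
  apply: sym_of_action; first by move=> x; rewrite /actB half_act1 ?swpK.
  by move=> a b x; rewrite /actB swpK half_actM.
pose o : X := (1, SylNil).
pose lead s (g : sym X) := let n := (g o).2 in if s then leadL n else leadR n.
have actAF f f' n : actA (i f) (f', n) = (f * f', n) by exact: half_actF.
have actBF f f' n : actB (j f) (f', n) = (f * f', n).
  by rewrite /actB /swp (half_actF phBK phBM) /= swap_sylK.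
have free_inj (C : groupType) (ga : C -> sym X) : {morph ga : x y / x * y} ->
    (forall c, ga c o = o -> c = 1) -> injective ga.
  by move=> gaM free; apply: morph_inj => // c c1; apply: free; rewrite c1.
exists (sym X), al, be, lead; split.
- split=> //; apply: free_inj => // c; rewrite ?alE ?beE.
    exact: half_act_free.
  rewrite /actB => /(congr1 (@swp _ _)); rewrite swpK; exact: half_act_free.
- by move=> f; apply: sym_eq => -[f' n]; rewrite alE beE actAF actBF.
- by move=> f [] /=; rewrite /lead /= alE actAF.
- by move=> [] g; rewrite /lead /=; case: (g o).2.
- split=> [a g aF|b g bF]; rewrite /lead /= ?alE ?beE.
    exact: half_act_lead.
  move=> gR; rewrite /actB /swp /= leadR_swap.
  by apply: (half_act_lead jM psBK phBM bF); rewrite /= leadL_swap.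
Qed.

(** * Words and presented groups *)

Section WordValue.
Variables (X : Type) (G : groupType) (g : X -> G).
Implicit Types (l : letter X) (u v w : word X).

Definition letter_value l : G := if l.2 then (g l.1)^-1 else g l.1.
Definition word_value w : G := foldr (fun l x => letter_value l * x) 1 w.

Lemma letter_value_inv l : letter_value (letter_inv l) = (letter_value l)^-1.
Proof. by case: l => x [] /=; rewrite /letter_value //= invgK. Qed.

Lemma word_value_cat u v : word_value (u ++ v) = word_value u * word_value v.
Proof. by elim: u => [|l u IHu] /=; rewrite ?mul1g // IHu mulgA. Qed.

Lemma word_value1 l : word_value [:: l] = letter_value l.
Proof. exact: mulg1. Qed.

Lemma word_value_nseq n l : word_value (nseq n l) = letter_value l ^+ n.
Proof. by elim: n => //= n ->; rewrite expgS. Qed.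

End WordValue.

Lemma word_value_morph (X : eqType) (G H : groupType) (f : G -> H)
    (g : X -> G) (h : X -> H) (w : word X) :
    {morph f : x y / x * y} -> (forall l, l \in w -> f (g l.1) = h l.1) ->
  word_value h w = f (word_value g w).
Proof.
move=> fM; elim: w => [_|l w IHw fg] /=; first by rewrite morph_one.
rewrite fM IHw => [|l' lw]; last by apply: fg; rewrite inE lw orbT.
congr (_ * _); rewrite /letter_value; case: l.2; rewrite ?(morph_inv fM);
by rewrite fg // mem_head.
Qed.

Lemma word_value_map (X Y : Type) (G : groupType) (r : X -> Y) (g : Y -> G)
    (w : word X) :
  word_value g [seq (r l.1, l.2) | l <- w] = word_value (g \o r) w.
Proof. by elim: w => //= l w ->. Qed.

Lemma word_value_inv (X : choiceType) (G : groupType) (g : X -> G) (w : word X) :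
  word_value g (word_inv w) = (word_value g w)^-1.
Proof.
elim: w => [|l w IHw]; first by rewrite invg1.
rewrite -cat1s word_inv_cat !word_value_cat IHw invgM; congr (_ * _).
by rewrite !word_value1 letter_value_inv.
Qed.

Section Presented.
Variables (X : choiceType) (R : seq (word X * word X)).

Lemma word_value_pres (G : groupType) (g : X -> G) (u v : word X) :
    (forall l r, (l, r) \in R -> word_value g l = word_value g r) ->
  pres_eq R u v -> word_value g u = word_value g v.
Proof.
move=> gR; elim=> {u v} [//|u v _ -> //|u v w _ -> _ //|u u' v v' _ IHu _ IHv|l|l r /gR //].
  by rewrite !word_value_cat IHu IHv.
by rewrite /= letter_value_inv mulg1 mulgV.
Qed.

Lemma word_value_class (w : word X) :
  word_value (@pres_gen X R) w = pres_class R w.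
Proof.
elim: w => //= l w ->; rewrite -[l :: w]cat1s -pres_mulE; congr (_ * _).
case: l => x [] //; rewrite /letter_value /=.
exact: (pres_invE R [:: (x, false)]).
Qed.

Lemma pres_one_eq (w : word X) : pres_class R w = 1 <-> pres_eq R w [::].
Proof. exact: pres_classP. Qed.

Definition pres_lift (G : groupType) (g : X -> G) (x : presented_group R) : G :=
  word_value g (repr x).

Section Lift.
Variables (G : groupType) (g : X -> G).
Hypothesis gR : forall l r, (l, r) \in R -> word_value g l = word_value g r.

Lemma pres_liftE w : pres_lift g (pres_class R w) = word_value g w.
Proof. by apply: word_value_pres gR _; apply: pres_repr. Qed.

Lemma pres_liftM : {morph @pres_lift G g : x y / x * y}.
Proof.
elim/pres_classW => u; elim/pres_classW => v.
by rewrite [_ * _]pres_mulE !pres_liftE word_value_cat.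
Qed.

End Lift.
End Presented.

(** Free reduction removes the letters of a given generator in pairs. *)
Lemma pres_free_odd (X : choiceType) (x : X) (u v : word X) :
    pres_eq [::] u v ->
  odd (count [pred l | l.1 == x] u) = odd (count [pred l | l.1 == x] v).
Proof.
elim=> {u v} [//|u v _ -> //|u v w _ -> _ //|u u' v v' _ IHu _ IHv|l|//].
  by rewrite !count_cat !oddD IHu IHv.
by rewrite /= addn0 addnn odd_double.
Qed.

(** * Free groups of rank two by ping-pong *)

Section FreeReduction.
Variable X : choiceType.

Definition reduced (w : word X) :=
  sorted (fun l l' => l' != letter_inv l) w.

Lemma reduced_pres (w : word X) :
  exists2 w', reduced w' & pres_eq [::] w w'.
Proof.
elim: w => [|l w [[|l' w'] rw' ww']]; first by exists [::] => //; apply: pres_refl.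
  exists [:: l] => //; rewrite -cat1s -[in X in pres_eq _ _ X](cats0 [:: l]).
  by apply: pres_cat ww'; apply: pres_refl.
have lw : pres_eq [::] (l :: w) (l :: l' :: w').
  by rewrite -(cat1s l w) -(cat1s l (l' :: w')); apply: pres_cat ww'; apply: pres_refl.
have [E|ne] := eqVneq l' (letter_inv l); last first.
  by exists [:: l, l' & w'] => //=; rewrite ne.
exists w'; first exact: path_sorted rw'.
apply: pres_trans lw _; rewrite E -[_ :: _]/([:: l; letter_inv l] ++ w').
rewrite -[X in pres_eq _ _ X]cat0s.
by apply: pres_cat; [apply: pres_cancel|apply: pres_refl].
Qed.

End FreeReduction.

(** The infinite cyclic group, as a multiplicative copy of the integers. *)
Definition cyc : Type := int.
HB.instance Definition _ := Choice.on cyc.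
HB.instance Definition _ :=
  isGroup.Build cyc (@addrA int) (@add0r int) (@addr0 int) (@addNr int) (@addrN int).

Definition cyc_gen : cyc := (1%R : int).

Lemma cycM (k l : cyc) : k * l = (k + l :> int)%R. Proof. by []. Qed.

Definition cyc_pow (b : bool) (n : nat) : cyc := if b then (- Posz n)%R else Posz n.

(** Two infinite cyclic groups, p true and p false; [lead s] should hold of the
    products whose leftmost syllable comes from p s. *)
Section PingPong.
Variables (G : groupType) (p : bool -> cyc -> G) (lead : bool -> G -> bool).
Hypothesis pM : forall s, {morph p s : x y / x * y}.
Hypothesis lead1 : forall s, ~~ lead s 1.
Hypothesis lead_uniq : forall s g, lead s g -> ~~ lead (~~ s) g.
Hypothesis lead_mul : forall s (k : cyc) g,
  k <> 1 -> ~~ lead s g -> lead s (p s k * g).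

Let g s : G := p s cyc_gen.

Lemma letter_value_cyc s b : letter_value g (s, b) = p s (cyc_pow b 1).
Proof.
by rewrite /letter_value /=; case: b; rewrite // -(morph_inv (pM s)).
Qed.

(** The induction groups the initial run of equal letters of w into one syllable,
    which is not trivial because a reduced word never mixes s with its inverse in a
    run. *)
Lemma ping_pong_reduced (w : word bool) :
  reduced w -> w != [::] -> exists s, lead s (word_value g w).
Proof.
suff H : reduced w -> match w with
    | [::] => True
    | (s, b) :: _ => exists (k : nat) h,
        word_value g w = p s (cyc_pow b k.+1) * h /\ ~~ lead s h
    end.
  case: w H => [//|[s b] w] H /H{H}[k [h [-> hs]]] _; exists s.
  by apply: lead_mul hs; case: b.
elim: w => [//|[s b] [|[s' b'] w] IHw rw].
  by exists 0, 1; rewrite word_value1 mulg1 letter_value_cyc.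
have [k [h [E hs]]] := IHw (path_sorted rw).
have -> : word_value g [:: (s, b), (s', b') & w] =
  letter_value g (s, b) * word_value g ((s', b') :: w) by [].
rewrite E letter_value_cyc.
have [ss'|ss'] := eqVneq s s'; last first.
  exists 0, (p s' (cyc_pow b' k.+1) * h); split=> //.
  have -> : s = ~~ s' by case: s s' ss' {IHw rw E hs} => [] [].
  by apply/lead_uniq/lead_mul => //; case: (b').
have bb' : b = b'.
  by move: rw; rewrite /= ss' /letter_inv /= => /andP[]; case: b b' {IHw E} => [] []; rewrite ?eqxx.
subst s' b'; exists k.+1, h; split=> //; rewrite mulgA -pM; congr (p s _ * _).
by rewrite cycM /cyc_pow; case: (b) => //; rewrite -opprD.
Qed.

Lemma ping_pong (w : word bool) :
  pres_eq [::] w [::] \/ exists s, lead s (word_value g w).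
Proof.
have [w' rw' ww'] := reduced_pres w.
have [w0|w0] := eqVneq w' [::]; first by left; rewrite -w0.
by right; rewrite (word_value_pres _ ww') //; apply: ping_pong_reduced.
Qed.

End PingPong.

(** * A quotient of < x, y | x^-n y x^n = y^2 > *)

(** The semidirect product of the integers with the functions on the integers, on
    which they act by translation: (k, f) (l, g) = (k + l, f (. + l) + g). *)
Definition shift_group : Type := (int * (int -> rat))%type.

Section ShiftGroup.
Local Open Scope ring_scope.
Implicit Types x y : shift_group.

Definition shift_one : shift_group := (0, fun=> 0).
Definition shift_mul x y : shift_group :=
  (x.1 + y.1, fun p => x.2 (p + y.1) + y.2 p).
Definition shift_inv x : shift_group := (- x.1, fun p => - x.2 (p - x.1)).

Lemma shift_eq x y : x.1 = y.1 -> x.2 =1 y.2 -> x = y.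
Proof. by case: x y => [k f] [l g] /= -> /funext ->. Qed.

Fact shift_mulA : associative shift_mul.
Proof.
move=> x y z; apply: shift_eq => [|p] /=; first exact: addrA.
by rewrite addrA [in LHS](addrC y.1) [in LHS](addrA p).
Qed.
Fact shift_mul1 : left_id shift_one shift_mul.
Proof. by move=> x; apply: shift_eq => [|p] /=; rewrite add0r. Qed.
Fact shift_mulr1 : right_id shift_one shift_mul.
Proof. by move=> x; apply: shift_eq => [|p] /=; rewrite !addr0. Qed.
Fact shift_mulV : left_inverse shift_one shift_inv shift_mul.
Proof. by move=> x; apply: shift_eq => [|p] /=; rewrite ?addrK addNr. Qed.
Fact shift_mulrV : right_inverse shift_one shift_inv shift_mul.
Proof. by move=> x; apply: shift_eq => [|p] /=; rewrite ?addrN. Qed.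

HB.instance Definition _ := gen_eqMixin shift_group.
HB.instance Definition _ := gen_choiceMixin shift_group.
HB.instance Definition _ := isGroup.Build shift_group
  shift_mulA shift_mul1 shift_mulr1 shift_mulV shift_mulrV.

(** The element (0, weight n) plays the role of y, and (1, 0) that of x: translating
    the weight by n.+1 doubles it.  Its support is restricted to the multiples of
    n.+1, so that for n > 0 its translates by consecutive integers are disjointly
    supported. *)
Definition weight (n : nat) (p : int) : rat :=
  if (n.+1 %| p)%Z then 2%:R ^ (p %/ n.+1)%Z else 0.

Lemma weight0 n : weight n 0 = 1.
Proof. by rewrite /weight dvdz0 div0z. Qed.

Lemma weight_shift n (p : int) : weight n (p + n.+1) = 2%:R * weight n p.
Proof.
rewrite /weight rpredDr ?dvdzz //; case: ifP => [np|_]; last by rewrite mulr0.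
by rewrite divzDr ?dvdzz // divzz addrC expfzDr.
Qed.

Definition shift_x (k : cyc) : shift_group := (k, fun=> 0).
Definition shift_y (n : nat) (k : cyc) : shift_group :=
  (0, fun p => weight n p *~ k).

Lemma shift_xM : {morph shift_x : k l / (k * l)%g}.
Proof. by move=> k l; apply: shift_eq => // p /=; rewrite addr0. Qed.

Lemma shift_yM n : {morph shift_y n : k l / (k * l)%g}.
Proof. by move=> k l; apply: shift_eq => // p /=; rewrite addr0 -mulrzDr. Qed.

Lemma shift_x_inj : injective shift_x.
Proof. by move=> k l []. Qed.

Lemma shift_y_inj n : injective (shift_y n).
Proof.
move=> k l [/(congr1 (fun f => f 0))]; rewrite weight0 => /eqP.
by rewrite eqr_int => /eqP.
Qed.

Lemma shift_xy n k l : shift_x k = shift_y n l -> k = 1%g.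
Proof. by case. Qed.

Lemma shift_yx n k l : shift_y n k = shift_x l -> k = 1%g.
Proof.
case=> _ /(congr1 (fun f => f 0)); rewrite weight0 => /eqP.
by rewrite intr_eq0 => /eqP.
Qed.

Lemma cyc_expn (k : cyc) n : (k ^+ n)%g = k *+ n.
Proof. by elim: n => [|n IHn] //; rewrite expgS IHn [RHS]mulrS. Qed.

Lemma shift_rel n :
  ((shift_x cyc_gen ^+ n.+1)^-1 * shift_y n cyc_gen * shift_x cyc_gen ^+ n.+1)%g
  = (shift_y n cyc_gen ^+ 2)%g.
Proof.
rewrite -!(morph_expn shift_xM n.+1) -(morph_expn (@shift_yM n) 2) !cyc_expn.
apply: shift_eq => [|p] /=; first by rewrite addr0 addNr.
by rewrite oppr0 add0r addr0 /cyc_gen natz weight_shift mulr_natl mulr1z.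
Qed.

End ShiftGroup.

(** * A faithful model of the square of relators *)

Definition free2 : groupType := presented_group (X := bool) [::].

(** Two consecutive edges of the square, with y of the first edge glued to x of the
    second.  The outer generators (x of the first, y of the second) generate a free
    group that misses the middle generator: a power of an outer generator is never
    in the amalgamated subgroup, so every nontrivial reduced word in them has a
    leading syllable, whereas elements of the amalgamated subgroup have none.  The
    boolean [eps] chooses which of the two is named true. *)
Lemma edge_amalgam (n m : nat) :
  exists (A : groupType) (al be : shift_group -> A),
    [/\ [/\ {morph al : x y / x * y}, {morph be : x y / x * y},
            injective al & injective be],
        forall k, al (shift_y n k) = be (shift_x k)
      & forall (eps : bool) (w : word bool),
          let g s := if s (+) eps then al (shift_x cyc_gen)
                     else be (shift_y m cyc_gen) in
          (word_value g w = 1 -> pres_eq [::] w [::]) /\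
          word_value g w <> al (shift_y n cyc_gen)].
Proof.
have [A [al [be [lead [[alM beM al_inj be_inj] E leadF lead_uniq [leadL leadR]]]]]] :=
  amalgam (@shift_yM n) shift_xM (@shift_y_inj n) shift_x_inj.
exists A, al, be; split=> // eps w g.
pose p s k := if s (+) eps then al (shift_x k) else be (shift_y m k).
have F s k : lead s (al (shift_y n k)) = false by apply/negbTE/leadF.
have A1 : 1 = al (shift_y n 1) :> A by rewrite (morph_one (@shift_yM n)) morph_one.
have pp : pres_eq [::] w [::] \/ exists s, lead (s (+) eps) (word_value g w).
  apply: (@ping_pong _ p (fun s => lead (s (+) eps))) => [s|s|s h|s k h k1].
  - by rewrite /p; case: (s (+) eps) => k l; rewrite ?shift_xM ?shift_yM ?alM ?beM.
  - by rewrite A1 F.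
  - by move/lead_uniq; rewrite addNb.
  - rewrite /p; case: (s (+) eps); [apply: leadL|apply: leadR] => f.
      by move/shift_xy/k1.
    by move/shift_yx/k1.
split.
  case: pp => // -[s ls] w1; move: ls; by rewrite w1 A1 F.
case: pp => [/word_value_pres ->//|[s ls] w1]; last by rewrite w1 F in ls.
by rewrite /= A1 => /al_inj/shift_y_inj.
Qed.

Definition next_gen (t : gen4) : gen4 :=
  match t with GenA => GenB | GenB => GenC | GenC => GenD | GenD => GenA end.

(** The two generators at the ends of the edge t of the square; the letter true
    stands for the conjugating generator x, false for the squared generator y. *)
Definition edge_gen (T : Type) (g : gen4 -> T) (t : gen4) (s : bool) : T :=
  if s then g t else g (next_gen t).

Definition shift_gen (n : nat) (s : bool) : shift_group :=
  if s then shift_x cyc_gen else shift_y n cyc_gen.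

(** The group G satisfies the relators x^-n y x^n = y^2 with n = (e t).+1 along the
    four edges, and its subgroup over each edge maps onto the group generated by
    [shift_gen]. *)
Definition square_model (e : gen4 -> nat) (G : groupType) (g : gen4 -> G) :=
  (forall t, (g t ^+ (e t).+1)^-1 * g (next_gen t) * g t ^+ (e t).+1
             = g (next_gen t) ^+ 2) /\
  (forall t w, word_value (edge_gen g t) w = 1 ->
     word_value (shift_gen (e t)) w = 1).

(** The generator after t is not in the subgroup of the three others, and t and the
    opposite generator are free. *)
Definition corner_free (G : groupType) (g : gen4 -> G) (t : gen4) :=
  (forall w, all [pred l | l.1 != next_gen t] w -> word_value g w <> g (next_gen t)) /\
  (forall w : word bool,
     word_value (fun s => if s then g t else g (next_gen (next_gen t))) w = 1 ->
     pres_eq [::] w [::]).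

(** The corners a, b, c and c, d, a are two instances of [edge_amalgam]; they are
    amalgamated along the free group on a and c.  As b is outside this free group in
    the first factor, it is outside the second factor, which contains c, d, a. *)
Lemma square_model_exists (e : gen4 -> nat) :
  exists (G : groupType) (g : gen4 -> G), square_model e g /\ corner_free g GenA.
Proof.
have [A [ka [kb [[kaM kbM ka_inj kb_inj] Eab chA]]]] := edge_amalgam (e GenA) (e GenB).
have [B [kc [kd [[kcM kdM kc_inj kd_inj] Ecd chB]]]] := edge_amalgam (e GenC) (e GenD).
pose o : cyc := cyc_gen.
pose gA t := match t with
  | GenA => ka (shift_x o) | GenB => ka (shift_y (e GenA) o)
  | GenC => kb (shift_y (e GenB) o) | GenD => 1 end.
pose gB t := match t with
  | GenC => kc (shift_x o) | GenD => kc (shift_y (e GenC) o)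
  | GenA => kd (shift_y (e GenD) o) | GenB => 1 end.
pose ac s := if s then GenA else GenC.
have chA' w := chA false w; have chB' w := chB true w.
(* The free generator true is a and false is c in both factors; in the second
   factor a comes last, whence the opposite value of eps. *)
have gAE : (fun s => if s (+) false then ka (shift_x o) else kb (shift_y (e GenB) o))
   = gA \o ac by apply/funext => -[].
have gBE : (fun s => if s (+) true then kc (shift_x o) else kd (shift_y (e GenD) o))
   = gB \o ac by apply/funext => -[].
rewrite /= gAE in chA'; rewrite /= gBE in chB'.
have no_rel (H : groupType) (g : bool -> H) l r :
  (l, r) \in ([::] : seq (word bool * word bool)) ->
  word_value g l = word_value g r by [].
have inj (H : groupType) (g : bool -> H) :
    (forall w, word_value g w = 1 -> pres_eq [::] w [::]) ->
  injective (pres_lift g : free2 -> H).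
  move=> gw; apply: morph_inj; first exact: pres_liftM (no_rel H g).
  elim/pres_classW => w; rewrite (pres_liftE (no_rel H g)) => /gw.
  exact: (pres_one_eq [::] w).2.
have i_inj := inj A _ (fun w => (chA' w).1).
have j_inj := inj B _ (fun w => (chB' w).1).
have iM := pres_liftM (no_rel A (gA \o ac)).
have jM := pres_liftM (no_rel B (gB \o ac)).
have [G [al [be [lead [[alM beM al_inj be_inj] E leadF lead_uniq [leadL leadR]]]]]] :=
  amalgam iM jM i_inj j_inj.
have Eac s : al (gA (ac s)) = be (gB (ac s)).
  have := E (pres_gen [::] s); rewrite !pres_liftE // !word_value1.
  by rewrite /letter_value /=.
(* The factors meet in the amalgamated subgroup: otherwise the common element
   would have leading syllables of both kinds. *)
have cap x y : al x = be y ->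
    (exists f : free2, x = pres_lift (gA \o ac) f) /\
    (exists f : free2, y = pres_lift (gB \o ac) f).
  move=> xy; have [[f xf]|xF] := pselect (exists f : free2, x = pres_lift (gA \o ac) f).
    by split; exists f => //; apply: be_inj; rewrite -E -xf.
  have [[f yf]|yF] := pselect (exists f : free2, y = pres_lift (gB \o ac) f).
    by case: xF; exists f; apply: al_inj; rewrite E -yf.
  have lead1 s : ~~ lead s 1 by rewrite -(morph_one alM) -(morph_one iM) leadF.
  have := leadL x 1 _ (lead1 _); rewrite mulg1 xy => lx.
  have := leadR y 1 _ (lead1 _); rewrite mulg1 => ly.
  have /lead_uniq/negP[] : lead true (be y) by apply: lx => f xf; apply: xF; exists f.
  by apply: ly => f yf; apply: yF; exists f.
pose g t := if t is GenD then be (gB GenD) else al (gA t).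
have gA_g t : t != GenD -> al (gA t) = g t by case: t; rewrite ?eqxx.
have gB_g t : t != GenB -> be (gB t) = g t.
  by case: t; rewrite ?eqxx //= => _; [rewrite -(Eac true)|rewrite -(Eac false)].
have wB w : all [pred l | l.1 != GenB] w -> word_value g w = be (word_value gB w).
  by move/allP => wD; apply: word_value_morph => // l /wD; apply: gB_g.
have edge t : exists2 k : shift_group -> G,
    {morph k : x y / x * y} /\ injective k & edge_gen g t =1 k \o shift_gen (e t).
  case: t.
  - exists (al \o ka); last by case.
    by split=> [x y|]; [rewrite /= kaM alM|exact: inj_comp].
  - exists (al \o kb); last by case=> //=; rewrite -Eab.
    by split=> [x y|]; [rewrite /= kbM alM|exact: inj_comp].
  - exists (be \o kc); last by case=> //=; rewrite -(Eac false).
    by split=> [x y|]; [rewrite /= kcM beM|exact: inj_comp].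
  - exists (be \o kd); last by case=> /=; [rewrite -Ecd|rewrite -(Eac true)].
    by split=> [x y|]; [rewrite /= kdM beM|exact: inj_comp].
exists G, g; split; first split.
- move=> t; have [k [kM _] gk] := edge t.
  have := gk true; have := gk false; rewrite /= => -> ->.
  by rewrite -!(morph_expn kM) -(morph_inv kM) -!kM shift_rel.
- move=> t w; have [k [kM k_inj] gk] := edge t.
  rewrite (word_value_morph kM (g := shift_gen (e t))) => [|l _]; last by rewrite gk.
  by rewrite -[1](morph_one kM) => /k_inj.
split=> w.
- move/wB => -> /esym/cap[[f Ef] _]; case: (chA' (repr f)) => _; apply.
  exact: (esym Ef).
move=> w1; apply: (chA' w).1; apply: al_inj; rewrite (morph_one alM) -[RHS]w1.
by symmetry; apply: word_value_morph => // -[[] b].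
Qed.

(** Rotating the exponents along the square moves the free corner to any t. *)
Lemma square_model_at (e : gen4 -> nat) t :
  exists (G : groupType) (g : gen4 -> G), square_model e g /\ corner_free g t.
Proof.
have step (P : gen4 -> Prop) : P GenA -> (forall t, P t -> P (next_gen t)) -> forall t, P t.
  by move=> PA PS t'; case: t'; do ?[exact: PA|apply: (PS GenA)|apply: (PS GenB)|apply: (PS GenC)].
move: e; elim/step: t => [|t IH] e; first exact: square_model_exists.
have [G [g [[rel inj] [th1 th2]]]] := IH (e \o next_gen).
pose prev_gen := next_gen \o next_gen \o next_gen.
have next_genK : cancel next_gen prev_gen by case.
have prev_genK : cancel prev_gen next_gen by case.
exists G, (g \o prev_gen); split; split.
- by case; [exact: (rel GenD)|exact: (rel GenA)|exact: (rel GenB)|exact: (rel GenC)].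
- by case; [exact: (inj GenD)|exact: (inj GenA)|exact: (inj GenB)|exact: (inj GenC)].
- move=> w wt; rewrite /= next_genK -(word_value_map prev_gen); apply: th1.
  by rewrite all_map; apply: sub_all wt => l; apply: contraNN => /= /eqP <-; rewrite prev_genK.
- by move=> w; rewrite /= !next_genK; apply: th2.
Qed.

(** * Three restrictions on the trivial words of Gamma *)

(** One less than the exponent n in the relator x^-n y x^n = y^2 with x = t. *)
Definition rel_exp (t : gen4) : nat :=
  match t with GenA => 0 | GenB => 1 | GenC => 2 | GenD => 3 end.

Definition rel_of (t : gen4) := conj_square (rel_exp t).+1 t (next_gen t).

Lemma Gamma_relsE : Gamma_rels = map rel_of [:: GenA; GenB; GenC; GenD].
Proof. by []. Qed.

Notation trivial w := (pres_eq Gamma_rels w [::]).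

Lemma square_model_rels (G : groupType) (g : gen4 -> G) l r : square_model rel_exp g ->
  (l, r) \in Gamma_rels -> word_value g l = word_value g r.
Proof.
case=> rel _; rewrite Gamma_relsE => /mapP[t _ lr].
have -> : l = (rel_of t).1 by rewrite -lr.
have -> : r = (rel_of t).2 by rewrite -lr.
have -> : (rel_of t).1 =
  nseq (rel_exp t).+1 (t, true) ++ [:: (next_gen t, false)] ++ nseq (rel_exp t).+1 (t, false).
  by [].
have -> : (rel_of t).2 = nseq 2 (next_gen t, false) by [].
rewrite 2!word_value_cat 3!word_value_nseq word_value1 /letter_value /=.
by rewrite expVgn mulgA -rel.
Qed.

Lemma square_model_eq (G : groupType) (g : gen4 -> G) u v : square_model rel_exp g ->
  pres_eq Gamma_rels u v -> word_value g u = word_value g v.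
Proof. by move=> mg; apply: word_value_pres => l r; apply: square_model_rels. Qed.

(** Solving for the single occurrence would put a generator in the subgroup of the
    three others. *)
Lemma count_letter_neq1 t w : trivial w -> count [pred l | l.1 == t] w != 1%N.
Proof.
have [s ->] : exists s, t = next_gen s.
  by case: t; [exists GenD|exists GenA|exists GenB|exists GenC].
have [G [g [mg [th _]]]] := square_model_at rel_exp s.
move=> /(square_model_eq mg) w1; apply/eqP => cw.
have /hasP[l lw /= /eqP lt] : has [pred l | l.1 == next_gen s] w by rewrite has_count cw.
case/splitPr: lw w1 cw => u v w1; rewrite count_cat /= lt eqxx addnCA add1n => -[] /eqP.
rewrite addn_eq0 !eqn0Ngt -!has_count -!all_predC => /andP[uN vN].
have vuN : all [pred l | l.1 != next_gen s] (v ++ u) by rewrite all_cat vN uN.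
have lE : letter_value g l = (word_value g (v ++ u))^-1.
  move: w1; rewrite word_value_cat /= => /(congr1 (fun x => (word_value g u)^-1 * x)).
  rewrite mulKg mulg1 => /(congr1 (fun x => x * (word_value g v)^-1)).
  by rewrite mulgK word_value_cat invgM.
move: lE; rewrite /letter_value lt; case: l.2 => [/invg_inj/esym|]; first exact: th.
rewrite -word_value_inv => /esym; apply: th.
by rewrite all_rev all_map; apply: sub_all vuN => -[].
Qed.

(** Opposite generators are free in the model, so w is trivial as a free word. *)
Lemma opposite_even t w s : trivial w ->
  all [pred l | (l.1 == t) || (l.1 == next_gen (next_gen t))] w ->
  ~~ odd (count [pred l | l.1 == s] w).
Proof.
have [G [g [mg [_ th]]]] := square_model_at rel_exp t.
move=> /(square_model_eq mg) w1 wt.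
pose f (l : letter gen4) : letter bool := (l.1 == t, l.2).
pose f' (b : bool) := if b then t else next_gen (next_gen t).
have wE : w = [seq (f' l.1, l.2) | l <- map f w].
  rewrite -map_comp map_id_in // => l /(allP wt) /= /orP[] /eqP lt.
    by rewrite /f' lt eqxx -lt; case: (l).
  by rewrite /f' lt; case: eqP => [/esym|_]; [case: (t)|rewrite -lt; case: (l)].
have fw : pres_eq [::] (map f w) [::].
  apply: th; rewrite -[RHS]/(word_value g [::]) -w1 [in RHS]wE word_value_map.
  by congr word_value; apply/funext => -[].
have odd0 b : ~~ odd (count [pred l | l.1 == b] (map f w)).
  by rewrite (pres_free_odd b fw).
rewrite wE count_map.
have [->|st] := eqVneq s t.
  rewrite (@eq_count _ _ [pred l | l.1 == true]) ?odd0 // => -[[] b] /=.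
    by rewrite eqxx.
  by case: (t); apply/eqP.
have [->|st'] := eqVneq s (next_gen (next_gen t)).
  rewrite (@eq_count _ _ [pred l | l.1 == false]) ?odd0 // => -[[] b] /=.
    by case: (t); apply/eqP.
  by rewrite eqxx.
rewrite (@eq_count _ _ pred0) ?count_pred0 // => -[[] b] /=.
  by rewrite eq_sym (negbTE st).
by rewrite eq_sym (negbTE st').
Qed.

Definition edge_letter (t : gen4) (l : letter bool) : letter gen4 :=
  (if l.1 then t else next_gen t, l.2).

(** The subgroup of the model over the edge t maps to the shift group. *)
Lemma edge_value t (u v : word bool) :
    pres_eq Gamma_rels (map (edge_letter t) u) (map (edge_letter t) v) ->
  word_value (shift_gen (rel_exp t)) u = word_value (shift_gen (rel_exp t)) v.
Proof.
have [G [g [mg _]]] := square_model_at rel_exp t.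
move=> /(square_model_eq mg).
rewrite !(word_value_map (fun s : bool => if s then t else next_gen t)).
have -> : g \o (fun s : bool => if s then t else next_gen t) = edge_gen g t.
  by apply/funext => -[].
move=> uv; apply/divg1_eq; rewrite -word_value_inv -word_value_cat.
by apply: mg.2; rewrite word_value_cat word_value_inv uv mulgV.
Qed.

Section ShiftWords.
Local Open Scope ring_scope.

(** * Short words in two adjacent generators *)

Definition sign_of (b : bool) : int := if b then -1 else 1.

Fixpoint x_exponent (w : word bool) : int :=
  if w is (s, b) :: w' then (if s then sign_of b else 0) + x_exponent w' else 0.

(** A letter y or y^-1 followed by a word w' contributes the weight, with this sign,
    translated by the x-exponent of w'. *)
Fixpoint y_terms (w : word bool) : seq (int * int) :=
  if w is (s, b) :: w' then
    (if s then y_terms w' else (sign_of b, x_exponent w') :: y_terms w')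
  else [::].

Lemma shift_value n w :
  (word_value (shift_gen n) w).1 = x_exponent w /\
  forall p, (word_value (shift_gen n) w).2 p =
    \sum_(t <- y_terms w) (weight n (p + t.2) *~ t.1).
Proof.
elim: w => [|[s b] w [IH1 IH2]] /=; first by split=> // p; rewrite big_nil.
split=> [|p] /=.
  by rewrite IH1 /letter_value; case: s; case: b; rewrite //= oppr0.
rewrite IH2 IH1 /letter_value; case: s; case: b => //=;
  rewrite ?oppr0 ?add0r ?big_cons ?subr0 ?mulr1z ?mulrN1z //.
Qed.

Fixpoint all_words (n : nat) : seq (word bool) :=
  if n is n'.+1 then
    [seq l :: w | l <- [:: (true, true); (true, false); (false, true); (false, false)],
                  w <- all_words n']
  else [:: [::]].

Lemma mem_all_words (w : word bool) : w \in all_words (size w).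
Proof.
elim: w => //= -[s b] w IHw; rewrite !mem_cat.
by case: s; case: b; rewrite map_f ?orbT.
Qed.

Definition cell : word bool :=
  [:: (true, false); (false, false); (false, false); (true, true); (false, true)].
(** All words that read a pentagon x y^2 x^-1 y^-1 from some vertex in some
    direction. *)
Definition cells : seq (word bool) :=
  [seq rot i cell | i <- iota 0 5] ++ [seq rot i (word_inv cell) | i <- iota 0 5].

Definition near0 (p : int) := p \in [:: 0; 1; -1].

Definition spread_sum (p : int) (ts : seq (int * int)) : int :=
  foldr (fun (t : int * int) (s : int) => (if p + t.2 == 0 then t.1 else 0) + s) 0 ts.

Definition dyadic_sum (ts : seq (int * int)) : int :=
  foldr (fun (t : int * int) (s : int) => t.1 * 2%:R ^+ absz (1 + t.2)%R + s) 0 ts.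

(** For exponents at least two the weight vanishes at 1 and -1, so that evaluation at
    p counts, with signs, the letters y translated by -p. *)
Lemma spread_sumE n p ts : all (fun t => near0 (p + t.2)) ts ->
  \sum_(t <- ts) (weight n.+1 (p + t.2) *~ t.1) = (spread_sum p ts)%:~R.
Proof.
elim: ts => [|t ts IHts] /=; first by rewrite big_nil.
case/andP=> tp /IHts IH; rewrite big_cons IH intrD; congr (_ + _).
move: (p + t.2) tp => q; rewrite /near0 !inE => /or3P[]/eqP->.
- by rewrite weight0 eqxx.
- by rewrite /weight mul0rz.
- by rewrite /weight mul0rz.
Qed.

(** For the exponent one the weight at q is the power 2^q; evaluating at 1 keeps the
    occurring powers integral. *)
Lemma dyadic_sumE ts : all (fun t => near0 t.2) ts ->
  \sum_(t <- ts) (weight 0 (1 + t.2) *~ t.1) = (dyadic_sum ts)%:~R.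
Proof.
elim: ts => [|t ts IHts] /=; first by rewrite big_nil.
case/andP=> tp /IHts IH; rewrite big_cons IH intrD; congr (_ + _).
rewrite -mulrzl intrM; congr (_ * _); rewrite /weight dvd1z divz1.
by move: t.2 tp => q; rewrite /near0 !inE => /or3P[]/eqP->.
Qed.

Definition spread_test (w : word bool) : bool :=
  has (fun p => all (fun t => near0 (p + t.2)) (y_terms w)
         && (spread_sum p (y_terms w) != 0)) [:: 0; 1; -1].

Definition dyadic_test (w : word bool) : bool :=
  (w \in cells) ||
  (all (fun t => near0 t.2) (y_terms w) && (dyadic_sum (y_terms w) != 0)).

(** A word of x-exponent zero has evenly many letters x.  With two of them it has
    three letters y, which are translated by at most two consecutive integers, and an odd
    number of signs over one of these does not cancel.  For the exponent one, all
    sums of three signed powers of two are compared with zero. *)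
Lemma words5_test :
  all (fun w => (x_exponent w != 0) || let k := count (fun l => l.1) w in
       ~~ odd k && ((k != 2%N) || spread_test w && dyadic_test w)) (all_words 5).
Proof. by vm_compute. Qed.

(** The finite computation turned into a statement about the shift group: a pentagon
    exists only for the relator with exponent one. *)
Lemma shift_word5 n (w : word bool) :
    size w = 5%N -> word_value (shift_gen n) w = 1%g ->
  let k := count (fun l => l.1) w in
  ~~ odd k /\ (k = 2%N -> n = 0%N /\ w \in cells).
Proof.
move=> sw w1 k; have [x1 x2] := shift_value n w.
have := allP words5_test w; rewrite -sw mem_all_words => /(_ isT).
rewrite -x1 w1 eqxx /= => /andP[-> H]; split=> // k2; move: H.
rewrite -/k k2 eqxx /= => /andP[/hasP[p _ /andP[pw p0]] dw].
have n0 : n = 0%N.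
  case: n w1 x1 x2 => // n w1 _ /(_ p); rewrite w1 /= spread_sumE // => /esym/eqP.
  by rewrite intr_eq0 (negbTE p0).
split=> //; case/orP: dw => // /andP[dw d0].
have := x2 1; rewrite w1 n0 /= dyadic_sumE // => /esym/eqP.
by rewrite intr_eq0 (negbTE d0).
Qed.

(** If b were true, so would b', and y^(t + u) would be x^n y^s x^-n, where s, t, u
    stand for signs.  As conjugating back by x^n doubles the exponent of y, the odd
    power y^s would be the even power y^(2 (t + u)). *)
Lemma shift_orient n s t u b b' :
    word_value (shift_gen n) ([:: (false, s)] ++ nseq n.+1 (true, b')) =
    word_value (shift_gen n) (nseq n.+1 (true, b) ++ [:: (false, t); (false, u)]) ->
  b = false.
Proof.
have xE c : word_value (shift_gen n) (nseq n.+1 (true, c)) =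
    shift_x (sign_of c *+ n.+1).
  rewrite word_value_nseq -cyc_expn (morph_expn shift_xM); congr (_ ^+ _)%g.
  by rewrite /letter_value; case: c; rewrite //= -(morph_inv shift_xM).
have yE c : letter_value (shift_gen n) (false, c) = shift_y n (sign_of c).
  by rewrite /letter_value; case: c; rewrite //= -(morph_inv (@shift_yM n)).
have yyE : word_value (shift_gen n) [:: (false, t); (false, u)] =
    shift_y n (sign_of t + sign_of u).
  by rewrite /word_value [foldr _ _ _]/= mulg1 !yE -shift_yM.
rewrite 2!word_value_cat word_value1 !xE yE yyE => -[].
rewrite add0r addr0 => E /(congr1 (fun f => f n.+1%:Z)) W.
(* At n.+1 the translate by - n.+1 on the left has weight 1, and the right-hand
   side has weight 2. *)
have {E W} : weight n (n.+1%:Z + sign_of b *+ n.+1) *~ sign_of s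
   = weight n (0 + n.+1%:Z) *~ (sign_of t + sign_of u).
  by move: W; rewrite E add0r addr0 add0r.
case: b => //; rewrite mulNrn natz addrN weight_shift weight0.
by case: s; case: (t); case: (u).
Qed.

End ShiftWords.

(** * Trivial words of length five *)

Lemma edge_letter_inj t : injective (edge_letter t).
Proof.
by move=> [s b] [s' b'] [+ ->]; case: s; case: s'; case: t.
Qed.

Lemma edge_word t (w : word gen4) :
    all [pred l | (l.1 == t) || (l.1 == next_gen t)] w ->
  exists w', w = map (edge_letter t) w' /\
    count (fun l => l.1) w' = count [pred l | l.1 == t] w.
Proof.
move=> wt; exists [seq (l.1 == t, l.2) | l <- w]; split; last by rewrite count_map.
rewrite -map_comp map_id_in // => l /(allP wt) /= /orP[] /eqP lt.
  by rewrite /edge_letter /= lt eqxx -lt; case: (l).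
by rewrite /edge_letter /= lt; case: eqP => [/esym|_]; [case: (t)|rewrite -lt; case: (l)].
Qed.

Definition Gamma_cells := map (map (edge_letter GenA)) cells.

Local Notation cnt t w := (count [pred l : letter gen4 | l.1 == t] w).

Lemma count_gen4 t (w : word gen4) :
  (cnt t w + cnt (next_gen t) w + cnt (next_gen (next_gen t)) w
   + cnt (next_gen (next_gen (next_gen t))) w = size w)%N.
Proof.
elim: w => //= l w IHw.
have -> : forall x y z u a b c d : nat, (x + a + (y + b) + (z + c) + (u + d)
   = (x + y + z + u) + (a + b + c + d))%N by lia.
rewrite IHw; suff -> : ((l.1 == t) + (l.1 == next_gen t) + (l.1 == next_gen (next_gen t)) +
  (l.1 == next_gen (next_gen (next_gen t))) = 1)%N by [].
have ne (x y : gen4) : x <> y -> (x == y) = false by move/eqP/negbTE.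
by case: l => -[] b; case: (t) => /=; rewrite eqxx !ne.
Qed.

Lemma two_types t t' (w : word gen4) : cnt t w = 0%N -> cnt t' w = 0%N ->
  forall s s', (forall x, [|| x == s, x == s', x == t | x == t']) ->
  all [pred l | (l.1 == s) || (l.1 == s')] w.
Proof.
move=> wt wt' s s' H; apply/allP => l lw /=.
have N u : cnt u w = 0%N -> (l.1 == u) = false.
  move=> wu; apply/negbTE/negP => lu.
  by have : has [pred l | l.1 == u] w; [apply/hasP; exists l|rewrite has_count wu].
by have := H l.1; rewrite (N _ wt) (N _ wt') !orbF.
Qed.

Lemma gen4_cover t x : [|| x == t, x == next_gen t, x == next_gen (next_gen t) |
   x == next_gen (next_gen (next_gen t))].
Proof. by case: x; case: t; rewrite eqxx ?orbT. Qed.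

(** Five is odd, so some generator t occurs an odd number of times, hence at least
    three times; the at most two remaining letters are equal up to inversion, since
    none is alone.  The word is thus written in t and one other generator.  Opposite
    generators are excluded by parity, and adjacent ones leave, after
    [shift_word5], only the pentagons of the relator a^-1 b a = b^2. *)
Lemma trivial5 (w : word gen4) : trivial w -> size w = 5%N -> w \in Gamma_cells.
Proof.
move=> w1 sw.
have n1 t : cnt t w != 1%N := count_letter_neq1 t w1.
have [t ot] : exists t, odd (cnt t w).
  have S := count_gen4 GenA w; rewrite sw /= in S.
  case oa : (odd (cnt GenA w)); first by exists GenA.
  case ob : (odd (cnt GenB w)); first by exists GenB.
  case oc : (odd (cnt GenC w)); first by exists GenC.
  by exists GenD; move: (congr1 odd S); rewrite !oddD oa ob oc.
pose u := next_gen (next_gen (next_gen t)).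
have tu : next_gen u = t by rewrite /u; case: (t).
have S := count_gen4 t w; rewrite sw -/u in S.
have : [\/ cnt (next_gen t) w = 0%N /\ cnt u w = 0%N,
    cnt (next_gen (next_gen t)) w = 0%N /\ cnt u w = 0%N
  | [/\ cnt (next_gen t) w = 0%N, cnt (next_gen (next_gen t)) w = 0%N & cnt u w = 2%N]].
  move: S ot (n1 t) (n1 (next_gen t)) (n1 (next_gen (next_gen t))) (n1 u).
  move: (cnt t w) (cnt (next_gen t) w) (cnt (next_gen (next_gen t)) w) (cnt u w) => a b c d.
  move=> S /negP oa /eqP a1 /eqP b1 /eqP c1 /eqP d1.
  have [b0|b0] := eqVneq b 0%N; have [c0|c0] := eqVneq c 0%N; have [d0|d0] := eqVneq d 0%N;
  try (by constructor 1); try (by constructor 2);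
  try (constructor 3; split=> //; lia); lia.
case=> [[cb cd]|[cc cd]|[cb cc cd]].
- have := opposite_even (t := t) t w1; rewrite ot => /(_ _)/negP[] //.
  apply: (two_types cb cd) => x; have := gen4_cover t x; rewrite -/u.
  by case/or4P=> ->; rewrite ?orbT.
- have [w' [ww' cw']] : exists w', w = map (edge_letter t) w' /\
    count (fun l => l.1) w' = cnt t w.
    apply: edge_word; apply: (two_types cc cd) => x; have := gen4_cover t x; rewrite -/u.
    by case/or4P=> ->; rewrite ?orbT.
  have /shift_word5[] : word_value (shift_gen (rel_exp t)) w' = 1.
    by rewrite -[RHS]/(word_value (shift_gen (rel_exp t)) [::]); apply: edge_value; rewrite -ww'.
    by rewrite -sw ww' size_map.
  by rewrite cw' ot.
have [w' [ww' cw']] : exists w', w = map (edge_letter u) w' /\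
    count (fun l => l.1) w' = cnt u w.
  apply: edge_word; rewrite tu; apply: (two_types cb cc) => x; have := gen4_cover t x; rewrite -/u.
  by case/or4P=> ->; rewrite ?orbT.
have /shift_word5[] : word_value (shift_gen (rel_exp u)) w' = 1.
  by rewrite -[RHS]/(word_value (shift_gen (rel_exp u)) [::]); apply: edge_value; rewrite -ww'.
  by rewrite -sw ww' size_map.
rewrite cw' cd => _ /(_ erefl)[eu wc].
have uA : u = GenA by case: (u) eu.
by rewrite ww' uA; apply: map_f.
Qed.

(** * Rigidity of the Cayley graph *)

Notation cl := (pres_class Gamma_rels).
Notation gen := (@pres_gen _ Gamma_rels).

Lemma cl_cat u v : cl (u ++ v) = (cl u : Gamma) * cl v.
Proof. by rewrite -pres_mulE. Qed.

Lemma cl_cons l v : cl (l :: v) = (cl [:: l] : Gamma) * cl v.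
Proof. by rewrite -cl_cat. Qed.

Lemma cl_nil : cl [::] = (1 : Gamma).
Proof. by []. Qed.

Lemma cl_inv l : cl [:: letter_inv l] = (cl [:: l] : Gamma)^-1.
Proof. exact/esym/(pres_invE Gamma_rels [:: l]). Qed.

Lemma Gamma_gensP (s : Gamma) : Gamma_gens s <-> exists l, s = cl [:: l].
Proof.
have E (x : gen4) : (pres_gen Gamma_rels x : Gamma)^-1 = cl [:: (x, true)].
  exact: (pres_invE Gamma_rels [:: (x, false)]).
rewrite /Gamma_gens /= !E; split.
  by case=> [[[[[[[]|]|]|]|]|]|] ->; eexists.
by case=> -[[] []] ->; rewrite /pres_gen; tauto.
Qed.

Lemma Gamma_rel t :
  pres_eq Gamma_rels ([:: (next_gen t, false)] ++ nseq (rel_exp t).+1 (t, false))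
    (nseq (rel_exp t).+1 (t, false) ++ [:: (next_gen t, false); (next_gen t, false)]).
Proof.
have : cl (rel_of t).1 = cl (rel_of t).2.
  apply/pres_classP/pres_rel; rewrite -surjective_pairing Gamma_relsE; apply: map_f.
  by case: t; rewrite !inE eqxx ?orbT.
have -> : (rel_of t).1 =
  nseq (rel_exp t).+1 (t, true) ++ [:: (next_gen t, false)] ++ nseq (rel_exp t).+1 (t, false).
  by [].
have -> : (rel_of t).2 = nseq 2 (next_gen t, false) by [].
move=> H; apply/pres_classP.
rewrite -[RHS]word_value_class word_value_cat.
rewrite (word_value_class Gamma_rels [:: (next_gen t, false); (next_gen t, false)]) -[cl [:: _; _]]H.
rewrite -!word_value_class !word_value_cat mulgA !word_value_nseq /letter_value /=.
by rewrite expVgn !mulgA mulgV mul1g.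
Qed.

(** Different generators are not equal or inverse, since neither occurs exactly once
    in a trivial word; x and x^-1 have different x-exponents. *)
Lemma cl1_inj l l' : cl [:: l] = cl [:: l'] -> l = l'.
Proof.
case: l l' => t b [t' b'] /pres_classP E.
have W : trivial ([:: (t, b)] ++ word_inv [:: (t', b')]).
  apply: pres_trans (pres_mulV Gamma_rels [:: (t', b')]).
  by apply: pres_cat E _; apply: pres_refl.
have := count_letter_neq1 t W; rewrite /= eqxx.
have [tt'|//] := eqVneq t' t; subst t' => _.
have /(congr1 fst) := @edge_value t [:: (true, b)] [:: (true, b')] E.
by rewrite !(shift_value _ _).1 /=; case: b b' {E W} => [] [].
Qed.

(** The pairs (x, y) such that some pentagon arrives at a vertex along the inverse of
    x and leaves it along y. *)
Definition links : seq (letter bool * letter bool) :=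
  [seq (letter_inv (last (true, false) w), head (true, false) w) | w <- cells].

Lemma links_middle x y : (x, y) \in links ->
  exists u, y :: rcons u (letter_inv x) \in cells.
Proof.
case/mapP => w wc [-> ->]; exists (behead (behead (belast (true, false) w))).
have : all (fun w => head (true, false) w ::
     rcons (behead (behead (belast (true, false) w))) (letter_inv (letter_inv (last (true, false) w)))
     \in cells) cells by vm_compute.
by move/allP; apply.
Qed.

Lemma middle_links x y u : y :: rcons u x \in cells -> (letter_inv x, y) \in links.
Proof.
by move=> /(map_f (fun w => (letter_inv (last (true, false) w), head (true, false) w)));
  rewrite /= last_rcons.
Qed.

(** The two a-edges of a pentagon are separated by b-edges. *)
Lemma links_bipartite x y : (x, y) \in links -> x.1 -> y.1 = false.
Proof.
move=> xy x1; have : all (fun p : letter bool * letter bool => p.1.1 ==> ~~ p.2.1) links by vm_compute.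
by move/allP => /(_ _ xy); rewrite /= x1 => /negbTE.
Qed.

Lemma cells_trivial w : w \in Gamma_cells -> trivial w.
Proof.
have rot_trivial i (u : word gen4) : trivial u -> trivial (rot i u).
  move/pres_classP => u1; apply/pres_classP; rewrite cl_cat.
  have : (cl (take i u) : Gamma) * cl (drop i u) = 1 by rewrite -cl_cat cat_take_drop.
  by move/mulg1_eq => <-; rewrite mulVg.
pose r := map (edge_letter GenA) cell.
have r1 : trivial r.
  have /pres_classP E : pres_eq Gamma_rels [:: (GenB, false); (GenA, false)]
    [:: (GenA, false); (GenB, false); (GenB, false)] := Gamma_rel GenA.
  apply/pres_classP.
  rewrite -[r]/([:: (GenA, false); (GenB, false); (GenB, false)] ++
               word_inv [:: (GenB, false); (GenA, false)]).
  by rewrite cl_cat -E -cl_cat; apply/pres_classP/pres_mulV.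
have rV : trivial (word_inv r) := pres_inv r1.
rewrite /Gamma_cells /cells map_cat mem_cat -!map_comp.
case/orP=> /mapP[i _ ->] /=; rewrite map_rot; apply: rot_trivial => //.
Qed.

(** An injective map f that sends edges to edges is described by a relabelling
    [sig v] of the letters at each vertex v. *)
Section Rigidity.
Variables (f : Gamma -> Gamma) (sig : Gamma -> letter gen4 -> letter gen4).
Hypothesis f_inj : injective f.
Hypothesis f_sig : forall v l, f (v * cl [:: l]) = f v * cl [:: sig v l].

(** The word read along the image under f of the walk that starts at v and reads w. *)
Fixpoint image_word (v : Gamma) (w : word gen4) : word gen4 :=
  if w is l :: w' then sig v l :: image_word (v * cl [:: l]) w' else [::].

Lemma image_word_cat v u w : image_word v (u ++ w) = image_word v u ++ image_word (v * cl u) w.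
Proof.
elim: u v => [|l u IHu] v /=; first by rewrite cl_nil mulg1.
by rewrite IHu (cl_cons l u) mulgA.
Qed.

Lemma size_image_word v w : size (image_word v w) = size w.
Proof. by elim: w v => //= l w IHw v; rewrite IHw. Qed.

Lemma f_image_word v w : f (v * cl w) = f v * cl (image_word v w).
Proof.
elim: w v => [|l w IHw] v; first by rewrite !mulg1.
by rewrite cl_cons mulgA IHw f_sig -mulgA -cl_cons.
Qed.

Lemma image_word_pres v u w :
  pres_eq Gamma_rels u w -> pres_eq Gamma_rels (image_word v u) (image_word v w).
Proof.
move/pres_classP => uw; apply/pres_classP.
by apply: (@mulgI _ (f v)); rewrite -!f_image_word uw.
Qed.

Lemma sig_inj v : injective (sig v).
Proof.
move=> l l' E; apply/cl1_inj/(@mulgI _ v)/f_inj.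
by rewrite !f_sig E.
Qed.

(** The edge from v labelled l is the edge labelled by the inverse of l at its other
    end. *)
Lemma sig_back v l : sig (v * cl [:: l]) (letter_inv l) = letter_inv (sig v l).
Proof.
apply: cl1_inj; rewrite cl_inv; apply/esym/mulg1_eq/(@mulgI _ (f v)).
by rewrite mulgA -!f_sig -mulgA cl_inv mulgV !mulg1.
Qed.

Definition preserves t := forall v b, (sig v (t, b)).1 = t.

(** The two letters of type t are permuted, so no other letter is sent to them. *)
Lemma preservesP t : preserves t -> forall v l, (sig v l).1 = t -> l.1 = t.
Proof.
move=> kt v l lt.
suff [b ->] : exists b, l = (t, b) by [].
have E b : sig v (t, b) = (t, (sig v (t, b)).2).
  by rewrite {1}[sig v (t, b)]surjective_pairing kt.
have [e1|e1] := eqVneq (sig v l) (sig v (t, true)); first by exists true; apply: sig_inj e1.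
exists false; apply: (@sig_inj v); move: e1.
have ne : sig v (t, true) <> sig v (t, false) by move/sig_inj.
move: ne; rewrite (E true) (E false); case: (sig v l) lt => _ c /= ->.
by move: (sig v (t, true)).2 (sig v (t, false)).2 c => [] [] [] //; rewrite eqxx.
Qed.

(** A straight line of type t stays straight: turning back would contradict
    injectivity. *)
Lemma preserves_nseq t : preserves t -> forall v b k,
  image_word v (nseq k (t, b)) = nseq k (t, (sig v (t, b)).2).
Proof.
move=> kt v b; move=> k; elim: k v => //= k IHk v; rewrite IHk.
have -> : sig v (t, b) = (t, (sig v (t, b)).2).
  by rewrite {1}[sig v (t, b)]surjective_pairing kt.
congr (_ :: nseq _ (t, _)) => /=.
set v' := v * _.
have B : sig v' (t, ~~ b) = (t, ~~ (sig v (t, b)).2).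
  by rewrite (sig_back v (t, b)) [sig v _]surjective_pairing kt.
have : sig v' (t, b) <> sig v' (t, ~~ b) by move/sig_inj => []; case: (b).
rewrite B [sig v' _]surjective_pairing kt.
by case: (sig v' _).2 (sig v _).2 => [] [].
Qed.

(** The image of y x^n = x^n y^2 is again an equality of words in x and y, with some
    signs; [shift_orient] determines the sign of x. *)
Lemma preserves_orient t : preserves t -> preserves (next_gen t) ->
  forall v, sig v (t, false) = (t, false).
Proof.
move=> kt kt' v; rewrite [sig v _]surjective_pairing kt.
have := image_word_pres v (Gamma_rel t).
rewrite !image_word_cat !(preserves_nseq kt) /=.
set b := (sig v (t, false)).2; set b' := (sig _ (t, false)).2.
set s := sig v _; set x := sig _ _; set y := sig _ _ => H.
congr (_, _); apply: (@shift_orient (rel_exp t) s.2 x.2 y.2 b b').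
apply: (@edge_value t); rewrite !map_cat !map_nseq /= /edge_letter /=.
have E z : z.1 = next_gen t -> (next_gen t, z.2) = z by case: z => ? ? /= ->.
by rewrite !E ?kt'.
Qed.

(** Pentagons go to pentagons. *)
Lemma sig_links v x y : (x, y) \in links ->
  exists x' y', [/\ (x', y') \in links, sig v (edge_letter GenA x) = edge_letter GenA x'
    & sig v (edge_letter GenA y) = edge_letter GenA y'].
Proof.
case/links_middle => u uc.
have /cells_trivial W := map_f (map (edge_letter GenA)) uc.
have := trivial5 (image_word_pres v W).
rewrite size_image_word size_map.
have -> : size (y :: rcons u (letter_inv x)) = 5%N.
  have : all (fun w => size w == 5%N) cells by vm_compute.
  by move/allP => /(_ _ uc)/eqP.
move=> /(_ erefl)/mapP[w wc].
rewrite /= map_rcons -cats1 image_word_cat /= cats1.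
case: w wc => // y' w; case/lastP: w => [_ /(congr1 size)|w x' wc].
  by rewrite /= size_rcons.
rewrite map_cons map_rcons => -[yE] /rcons_inj[_ xE].
exists (letter_inv x'), y'; split=> //; first exact: middle_links wc.
have e_inv l : edge_letter GenA (letter_inv l) = letter_inv (edge_letter GenA l) by [].
rewrite e_inv -xE -sig_back -e_inv letter_invK.
congr (sig _ _); move/pres_classP: W.
rewrite map_cons map_rcons -cats1 (cl_cons (edge_letter GenA y)) cl_cat => W.
by rewrite -!mulgA W mulg1.
Qed.

(** A letter b or b^-1 is linked to three others, and a or a^-1 only to b and b^-1;
    this pins down the b-edges, and then the a-edges as those linked to b-edges. *)
Lemma preserves_AB : preserves GenA /\ preserves GenB.
Proof.
have kB : preserves GenB.
  move=> v b.
  have l1 : ((false, b), (true, true)) \in links by case: (b); vm_compute.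
  have l2 : ((false, b), (true, false)) \in links by case: (b); vm_compute.
  have l3 : ((false, b), (false, ~~ b)) \in links by case: (b); vm_compute.
  have [x1 [y1 [m1 xE1 yE1]]] := sig_links v l1.
  have [x2 [y2 [m2 xE2 yE2]]] := sig_links v l2.
  have [x3 [y3 [m3 xE3 yE3]]] := sig_links v l3.
  have ? : x2 = x1 by apply: (@edge_letter_inj GenA); rewrite -xE1 -xE2.
  have ? : x3 = x1 by apply: (@edge_letter_inj GenA); rewrite -xE1 -xE3.
  subst x2 x3; rewrite -[(GenB, b)]/(edge_letter GenA (false, b)) xE1.
  case x11 : x1.1; last by rewrite /edge_letter /= x11.
  have n12 : y1 <> y2 by move=> E; have := yE1; rewrite E -yE2 => /sig_inj.
  have n13 : y1 <> y3 by move=> E; have := yE1; rewrite E -yE3 => /sig_inj.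
  have n23 : y2 <> y3 by move=> E; have := yE2; rewrite E -yE3 => /sig_inj.
  have := links_bipartite m1 x11; have := links_bipartite m2 x11.
  have := links_bipartite m3 x11.
  move: n12 n13 n23; case: y1 y2 y3 {m1 m2 m3 yE1 yE2 yE3} => [s1 c1] [s2 c2] [s3 c3] /=.
  by move=> n12 n13 n23 ? ? ?; subst s1 s2 s3; case: c1 c2 c3 n12 n13 n23 => [] [] [].
split=> // v b.
have l1 : ((true, b), (false, true)) \in links by case: (b); vm_compute.
have [x1 [y1 [m1 xE1 yE1]]] := sig_links v l1.
rewrite -[(GenA, b)]/(edge_letter GenA (true, b)) xE1.
case x11 : x1.1; first by rewrite /edge_letter /= x11.
have : (sig v (edge_letter GenA (true, b))).1 = GenB by rewrite xE1 /edge_letter x11.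
by move/(preservesP kB).
Qed.

(** The image of c b^2 = b^2 c^2 is a trivial word with four letters b or b^-1, and
    three letters of types c and d.  Neither type can occur exactly once, so the
    three have the same type, and by parity this type is not d, which is opposite to
    b. *)
Lemma preserves_C : preserves GenC.
Proof.
have [kA kB] := preserves_AB.
have types v l : l.1 = GenC \/ l.1 = GenD ->
    (sig v l).1 = GenC \/ (sig v l).1 = GenD.
  move=> lt; case E : (sig v l).1; [| |by left|by right].
    by have := preservesP kA E; case: lt => ->.
  by have := preservesP kB E; case: lt => ->.
have kpos v : (sig v (GenC, false)).1 = GenC.
  have := image_word_pres v (Gamma_rel GenB).
  rewrite !image_word_cat !(preserves_nseq kB) /=.
  set b := (sig v (GenB, false)).2; set b' := (sig _ (GenB, false)).2.
  set s := sig v _; set x := sig _ _; set y := sig _ _ => H.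
  have st : s.1 = GenC \/ s.1 = GenD by apply: types; left.
  have xt : x.1 = GenC \/ x.1 = GenD by apply: types; left.
  have yt : y.1 = GenC \/ y.1 = GenD by apply: types; left.
  pose W := [:: s; (GenB, b'); (GenB, b')] ++
            word_inv [:: (GenB, b); (GenB, b); x; y].
  have W1 : trivial W.
    apply: pres_trans (pres_mulV Gamma_rels [:: (GenB, b); (GenB, b); x; y]).
    by apply: pres_cat; [exact: H|exact: pres_refl].
  have nC := count_letter_neq1 GenC W1; have nD := count_letter_neq1 GenD W1.
  have oD := @opposite_even GenB W GenD W1.
  have ne (t t' : gen4) : t <> t' -> (t == t') = false by move/eqP/negbTE.
  move: nC nD oD; rewrite /W /=.
  by case: st => -> //; case: xt => ->; case: yt => ->;
     rewrite ?eqxx ?ne // => _ _ /(_ isT).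
move=> v [//|]; last exact: kpos.
(* The edge labelled c^-1 at v is the edge labelled c at v c^-1. *)
pose v0 := v * cl [:: (GenC, true)].
have := sig_back v0 (GenC, false).
rewrite /v0 -mulgA -cl_cat.
have -> : cl ([:: (GenC, true)] ++ [:: (GenC, false)]) = (1 : Gamma).
  by apply/pres_classP; apply: (pres_cancel _ (GenC, true)).
by rewrite mulg1 => ->; apply: kpos.
Qed.

Lemma preserves_D : preserves GenD.
Proof.
have [kA kB] := preserves_AB => v b.
case E : (sig v (GenD, b)).1 => //.
- by have := preservesP kA E.
- by have := preservesP kB E.
- by have := preservesP preserves_C E.
Qed.

Lemma sig_id v l : sig v l = l.
Proof.
have [kA kB] := preserves_AB.
have k t : preserves t by case: t; [|..|exact: preserves_D] => //; exact: preserves_C.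
have pos t w : sig w (t, false) = (t, false) by apply: preserves_orient.
case: l => t [] //.
have : sig v (t, true) <> sig v (t, false) by move/sig_inj.
rewrite pos [sig v _]surjective_pairing k.
by case: (sig v (t, true)).2.
Qed.

Lemma f_translation v g : f (v * g) = f v * g.
Proof.
elim/(@pres_classW _ Gamma_rels): g => w; rewrite f_image_word.
congr (_ * cl _); elim: w v => //= l w IHw v; by rewrite IHw sig_id.
Qed.
End Rigidity.

Lemma automorphism_translation (f : Gamma -> Gamma) :
  automorphism (cayley_adj Gamma_gens) f -> forall v g, f (v * g) = f v * g.
Proof.
case=> f_bij fadj.
have /choice[sig sigP] (vl : Gamma * letter gen4) :
    exists l', f (vl.1 * cl [:: vl.2]) = f vl.1 * cl [:: l'].
  have [_ H] := fadj vl.1 (vl.1 * cl [:: vl.2]).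
  have [|s /Gamma_gensP[l' ->] ->] := H; last by exists l'.
  by exists (cl [:: vl.2]) => //; apply/Gamma_gensP; exists vl.2.
apply: (@f_translation f (fun v l => sig (v, l))) => [|v l]; first exact: bij_inj.
exact: (sigP (v, l)).
Qed.

(** * Absence of finite quotients *)

Section Orders.
Local Open Scope nat_scope.

(** If 2^m = 1 modulo p, then the order of 2 divides both m and p - 1, hence is 1. *)
Lemma exp2_coprime p m : prime p -> 0 < m -> coprime m p.-1 ->
  2 ^ m <> 1 %[mod p].
Proof.
move=> pp m0 co m1; have p1 := prime_gt1 pp.
case: (egcdnP p.-1 m0) => k l E _; move: E; rewrite (eqP co) => E.
(* Multiplying Fermat's congruence 2^p = 2 keeps one factor 2, so that the
   argument covers p = 2, where 2 is not invertible. *)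
have F i : 2 ^ (i * p.-1 + 1) = 2 %[mod p].
  elim: i => // i IHi; rewrite mulSn addnAC addn1 prednK ?prime_gt0 // expnD.
  by rewrite -modnMml fermat_little // modnMml -expnS -[(_ * _).+1]addn1 IHi.
have : 2 ^ (k * m) = 1 %[mod p].
  by rewrite mulnC expnM -modnXm m1 modnXm exp1n.
rewrite E F => /eqP; rewrite eqn_mod_dvd // dvdn1 => /eqP p1E.
by rewrite p1E in p1.
Qed.

(** Higman's argument: let p be the least prime dividing some o t, and let s be the
    generator before t.  Then p divides 2^(o s) - 1, so by [exp2_coprime] the
    numbers o s and p - 1 have a common prime factor, and this factor is less
    than p. *)
Lemma higman_orders (o : gen4 -> nat) : (forall t, 0 < o t) ->
  (forall t, o (next_gen t) %| 2 ^ o t - 1) -> forall t, o t = 1.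
Proof.
move=> o_gt0 o_dvd t.
pose P q := prime q && `[< exists t, q %| o t >].
apply/eqP/negPn/negP => ot1.
have exP : exists q, P q.
  exists (pdiv (o t)); rewrite /P pdiv_prime; last by have := o_gt0 t; lia.
  by apply/asboolP; exists t; apply: pdiv_dvd.
case: (ex_minnP exP) => p /andP[pp /asboolP[t' pt']] min_p.
have [s st'] : exists s, t' = next_gen s.
  by case: (t'); [exists GenD|exists GenA|exists GenB|exists GenC].
apply: (@exp2_coprime p (o s)) => //; last first.
  apply/eqP; rewrite eqn_mod_dvd ?expn_gt0 //.
  by apply: dvdn_trans (o_dvd s); rewrite -st'.
rewrite /coprime; apply/negPn/negP => g1.
have g0 : 0 < gcdn (o s) p.-1 by rewrite gcdn_gt0 o_gt0.
have q_pr : prime (pdiv (gcdn (o s) p.-1)) by apply: pdiv_prime; lia.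
have q_dvd := pdiv_dvd (gcdn (o s) p.-1).
have /min_p : P (pdiv (gcdn (o s) p.-1)).
  rewrite /P q_pr; apply/asboolP; exists s.
  exact: dvdn_trans q_dvd (dvdn_gcdl _ _).
have := dvdn_leq _ (dvdn_trans q_dvd (dvdn_gcdr _ _)).
have := prime_gt1 pp; move: (pdiv _) => q p1 H; have := H ltac:(lia); lia.
Qed.

End Orders.

(** As the elements of H are left translations, right multiplication by Gamma acts on
    the set of H-orbits. *)
Section Orbits.
Variable H : set (Gamma -> Gamma).
Hypothesis H_sub : aut_subgroup (cayley_adj Gamma_gens) H.
Hypothesis H_fin : quasi_transitive H.

Let orb := aut_orbit H.

Lemma H_translation f v g : H f -> f (v * g) = f v * g.
Proof. by case: H_sub => sub _ _ _ /sub/automorphism_translation. Qed.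

Lemma orb_refl v : orb v v.
Proof. by case: H_sub => _ H1 _ _; exists id. Qed.

Lemma orb_eq f v : H f -> orb (f v) = orb v.
Proof.
case: H_sub => sub _ HM HV Hf; apply/seteqP; split=> _ [k Hk <-].
  by exists (k \o f) => //; apply: HM.
have [[f' fK f'K] _] := sub f Hf.
exists (k \o f'); last by rewrite /= fK.
exact: HM (HV f f' Hf fK f'K).
Qed.

Lemma orb_mul v w g : orb v = orb w -> orb (v * g) = orb (w * g).
Proof.
move=> vw; have : orb w v by rewrite -vw; apply: orb_refl.
by case=> f Hf <-; rewrite -H_translation // orb_eq.
Qed.

(** Membership in the kernel of the action on the set of orbits. *)
Definition orb_fix (g : Gamma) := forall v, orb (v * g) = orb v.

Lemma orb_fixM g k : orb_fix g -> orb_fix k -> orb_fix (g * k).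
Proof. by move=> fg fk v; rewrite mulgA fk fg. Qed.

Lemma orb_fixV g : orb_fix g -> orb_fix g^-1.
Proof. by move=> fg v; rewrite -(fg (v * g^-1)) mulgVK. Qed.

Lemma orb_fixJ g k : orb_fix g -> orb_fix (g ^ k).
Proof.
by move=> fg v; rewrite conjgE !mulgA -[in RHS](mulgVK k v); apply: orb_mul.
Qed.

Lemma orb_fixX g n : orb_fix g -> orb_fix (g ^+ n).
Proof.
move=> fg; elim: n => [|n IHn]; first by move=> v; rewrite mulg1.
by rewrite expgS; apply: orb_fixM.
Qed.

Lemma orb_pow v g n m : orb (v * g ^+ n) = orb v -> orb (v * g ^+ (n * m)) = orb v.
Proof.
move=> E; elim: m => [|m IHm]; first by rewrite muln0 mulg1.
by rewrite mulnS expgnDr mulgA (orb_mul _ E).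
Qed.

(** Pigeonhole on the finite set of orbits. *)
Lemma orb_return v g : exists n, orb (v * g ^+ n.+1) = orb v.
Proof.
have /finite_seqP[s sE] := H_fin.
pose r := [seq orb (v * g ^+ k) | k <- iota 0 (size s).+1].
have : ~~ uniq r.
  apply/negP => /uniq_leq_size H'.
  have : size r <= size s.
    apply: H' => _ /mapP[k _ ->].
    have : range (aut_orbit H) (orb (v * g ^+ k)) by exists (v * g ^+ k).
    by rewrite sE.
  by rewrite size_map size_iota ltnn.
move=> /(uniqPn (orb v))[i [j [ij]]]; rewrite size_map size_iota => js.
rewrite !(nth_map 0) ?size_iota ?(ltn_trans ij) // !nth_iota ?(ltn_trans ij) //.
rewrite !add0n => E; exists (j - i).-1; rewrite prednK ?subn_gt0 //.
have := orb_mul (g ^+ i)^-1 E; rewrite mulgK => ->.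
have -> : g ^+ j = g ^+ (j - i) * g ^+ i by rewrite -expgnDr subnK // ltnW.
by rewrite mulgA mulgK.
Qed.

Lemma orb_fix_pow g : exists n, orb_fix (g ^+ n.+1).
Proof.
have /finite_seqP[s sE] := H_fin.
suff [n nE] : exists n, forall v, orb v \in s -> orb (v * g ^+ n.+1) = orb v.
  exists n => v; apply: nE.
  have : range (aut_orbit H) (orb v) by exists v.
  by rewrite sE.
elim: s {sE} => [|o s [n IHs]]; first by exists 0.
have [[v0 v0o]|no] := pselect (exists v0, orb v0 = o); last first.
  exists n => v; rewrite inE => /orP[/eqP vo|/IHs//].
  by case: no; exists v.
have [m mE] := orb_return v0 g.
exists (m.+1 * n.+1).-1 => v; rewrite prednK // inE => /orP[/eqP vo|vs].
  by apply: orb_pow; rewrite vo -v0o -mE; apply: orb_mul; rewrite vo.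
by rewrite mulnC; apply: orb_pow; apply: IHs.
Qed.

(** The order of g in the finite quotient of Gamma acting on the orbits. *)
Lemma orb_fix_order g :
  exists2 n, 0 < n & forall m, n %| m <-> orb_fix (g ^+ m).
Proof.
have exP : exists n, `[< orb_fix (g ^+ n.+1) >].
  by have [n ?] := orb_fix_pow g; exists n; apply/asboolP.
case: (ex_minnP exP) => n /asboolP fn min_n; exists n.+1 => // m.
split=> [/dvdnP[q ->]|fm].
  by rewrite mulnC expgnA; apply: orb_fixX.
have : orb_fix (g ^+ (m %% n.+1)).
  rewrite -[g ^+ _](mulKg (g ^+ (m %/ n.+1 * n.+1))) -expgnDr -divn_eq.
  apply: orb_fixM => //; apply: orb_fixV.
  by rewrite mulnC expgnA; apply: orb_fixX.
rewrite /dvdn; case E : (m %% n.+1) => [//|k] fk.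
have /min_n : `[< orb_fix (g ^+ k.+1) >] by apply/asboolP.
by rewrite leqNgt -ltnS -E ltn_pmod.
Qed.

Lemma gen_rel t :
  (gen (next_gen t) : Gamma) ^ (gen t ^+ (rel_exp t).+1) = gen (next_gen t) ^+ 2.
Proof.
have cl_nseq n s : cl (nseq n (s, false)) = (gen s : Gamma) ^+ n.
  by elim: n => // n IHn; rewrite expgS -IHn -cl_cat.
have /pres_classP := Gamma_rel t; rewrite 2!cl_cat !cl_nseq.
by rewrite -[[:: _; _]]/(nseq 2 (next_gen t, false)) cl_nseq conjgE => ->; rewrite mulKg.
Qed.

(** Conjugating y by a power of x^n that acts trivially shows that y^(2^N) and y act
    in the same way, where N is the order of x; so the orders satisfy the
    divisibilities of [higman_orders]. *)
Lemma orb_fix_all t : orb_fix (gen t).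
Proof.
have /choice[o oP] (s : gen4) : exists n, 0 < n /\
    forall m, n %| m <-> orb_fix (gen s ^+ m).
  by have [n n0 nP] := orb_fix_order (gen s); exists n.
suff : o t = 1%N.
  by move=> o1; rewrite -[gen t]expg1; apply/(oP t).2; rewrite o1 dvd1n.
apply: higman_orders => s; first exact: (oP s).1.
apply/(oP _).2.
have conj_pow k : (gen (next_gen s) : Gamma) ^ (gen s ^+ ((rel_exp s).+1 * k)) = gen (next_gen s) ^+ (2 ^ k).
  elim: k => [|k IHk]; first by rewrite muln0 conjg1.
  by rewrite mulnS addnC expgnDr conjgM IHk conjXg gen_rel -expgnA expnSr mulnC.
have fx : orb_fix (gen s ^+ ((rel_exp s).+1 * o s)) by apply/(oP s).2/dvdn_mull.
rewrite -[gen _ ^+ _](mulKg (gen (next_gen s))) -expgS.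
rewrite subn1 prednK ?expn_gt0 // -conj_pow conjgE !mulgA.
by apply: orb_fixM => //; rewrite -mulgA; apply/orb_fixJ/orb_fixV.
Qed.

End Orbits.

(** * Height functions *)

Theorem theorem8p2 :
  ~ exists (h : Gamma -> int) (H : set (Gamma -> Gamma)),
      graph_height_function (cayley_adj Gamma_gens) 1%g h H.
Proof.
move=> [h [H [[H_sub H_fin] h1 h_inv h_adj]]].
(* Some f in H maps 1 to the generator, hence is left multiplication by it. *)
have hM t x : h (gen t * x) = (h (gen t) + h x)%R.
  have fix_t := orb_fix_all H_sub H_fin t 1.
  have : aut_orbit H (1 * gen t) (gen t).
    by rewrite mul1g; apply: orb_refl.
  rewrite fix_t => -[f Hf f1].
  have := h_inv x 1 f Hf; rewrite -[x in f x]mul1g (H_translation H_sub) // f1 h1.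
  by rewrite subr0 => ->; rewrite addrC subrK.
have hX t n x : h (gen t ^+ n * x) = (h (gen t) *+ n + h x)%R.
  by elim: n => [|n IHn]; rewrite ?mul1g ?add0r // expgS -mulgA hM IHn addrA mulrS.
have h0 s : h (gen (next_gen s)) = 0%R.
  have E : (gen (next_gen s) : Gamma) * (gen s ^+ (rel_exp s).+1 * 1) =
      gen s ^+ (rel_exp s).+1 * (gen (next_gen s) ^+ 2 * 1).
    by rewrite !mulg1 conjgC gen_rel.
  move/(congr1 h): E; rewrite hM !hX h1 !addr0 mulr2n addrC => /addrI/eqP.
  by rewrite -subr_eq0 opprD addNKr oppr_eq0 => /eqP.
have hgen t : h (gen t) = 0%R.
  by case: t; [exact: h0 GenD|exact: h0 GenA|exact: h0 GenB|exact: h0 GenC].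
have [u [w [_ [s /Gamma_gensP[[t b] ->] ->]]]] := h_adj 1.
rewrite mul1g h1 => /andP[_].
case: b => [|]; last by rewrite hgen.
have := hM t (cl [:: (t, true)]).
have -> : (gen t : Gamma) * cl [:: (t, true)] = 1.
  by rewrite -[cl _]/(cl [:: letter_inv (t, false)]) cl_inv mulgV.
by rewrite h1 hgen add0r => <-.
Qed.
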